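(* Let $N\in\mathcal{LC}$ be nonquasianalytic and satisfy $$\liminf_{p\to+\infty}\frac{\nu_p}{p}\sum_{k\ge 2p}\frac{1}{\nu_k}>0.$$ Then the following equivalent assertions are satisfied: (i) For all $s\in\mathbb{N}_{>0}$ we have $S^N\approx L^s$. (ii) $S^N$ is $\preceq$-maximal among all $M\in\mathcal{N}_{\preceq,R}$ satisfying $(M,N)_{SV}$, respectively among all $M\in\mathcal{N}_{\preceq,B}$ satisfying $(M,N)_{SV}$ (and also among all $M\in\mathcal{N}_{\preceq,\mathcal{LC},R}$, respectively $M\in\mathcal{N}_{\preceq,\mathcal{LC},B}$, satisfying $(M,N)_{SV}$). (iii) The inclusions $\mathcal{B}(\mathcal{D}_{\{N\}}([-1,1]))\supseteq\Lambda_{\{S^N\}}$, respectively $\mathcal{B}(\mathcal{D}_{(N)}([-1,1]))\supseteq\Lambda_{(S^N)}$, hold and are optimal in the ultradifferentiable setting, i.e. every $M\in\mathcal{N}_{\preceq,R}$ with $\mathcal{B}(\mathcal{D}_{\{N\}}([-1,1]))\supseteq\Lambda_{\{M\}}$, respectively every $M\in\mathcal{N}_{\preceq,B}$ with $\mathcal{B}(\mathcal{D}_{(N)}([-1,1]))\supseteq\Lambda_{(M)}$, satisfies $M\preceq S^N$.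
   Context: $\mathbb{N}=\{0,1,2,\dots\}$, $\mathbb{N}_{>0}=\{1,2,\dots\}$. $\mathcal{LC}$ is the set of sequences $N\in\mathbb{R}_{>0}^{\mathbb{N}}$ that are normalized ($1=N_0\le N_1$), log-convex ($N_j^2\le N_{j-1}N_{j+1}$ for $j\ge1$) and satisfy $\lim_{j\to\infty}(N_j)^{1/j}=+\infty$. Put $\nu_j:=N_j/N_{j-1}$ for $j\ge1$, $\nu_0:=1$. $N$ is nonquasianalytic if $\sum_{p\ge1}1/\nu_p<+\infty$. $M\preceq N$ means $\sup_{j\ge1}(M_j/N_j)^{1/j}<+\infty$; $M\approx N$ means $M\preceq N$ and $N\preceq M$. $K$ is called $\preceq$-maximal among the elements of a set $\mathcal{S}$ of sequences if $K\in\mathcal{S}$ and $M\preceq K$ for every $M\in\mathcal{S}$; in this terminology sequences are identified up to equivalence $\approx$. For the fixed $N$: $\mathcal{N}_{\preceq,R}:=\{M\in\mathbb{R}_{>0}^{\mathbb{N}}:\liminf_{p\to\infty}(M_p/p!)^{1/p}>0,\ M\preceq N\}$, $\mathcal{N}_{\preceq,B}:=\{M\in\mathbb{R}_{>0}^{\mathbb{N}}:\lim_{p\to\infty}(M_p/p!)^{1/p}=+\infty,\ M\preceq N\}$, $\mathcal{N}_{\preceq,\mathcal{LC},R}:=\mathcal{N}_{\preceq,R}\cap\mathcal{LC}$, $\mathcal{N}_{\preceq,\mathcal{LC},B}:=\mathcal{N}_{\preceq,B}\cap\mathcal{LC}$. Condition $(M,N)_{SV}$: there exists $s\in\mathbb{N}_{>0}$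 with $\sup_{p\ge1}\frac{\lambda^{M,N}_{p,s}}{p}\sum_{k\ge p}\frac1{\nu_k}<+\infty$, where $\lambda^{M,N}_{p,s}:=\sup_{0\le j<p}\left(\frac{M_p}{s^pN_j}\right)^{1/(p-j)}$. For $s\in\mathbb{N}_{>0}$: $L^s_0:=1$, $L^s_p:=s^p\min_{0\le j\le p-1}\left\{\left(\frac{p}{\sum_{k\ge p}1/\nu_k}\right)^{p-j}N_j\right\}$ for $p\ge1$. The descendant $S^N$ of $N$: with $\tau_p:=\frac{p}{\nu_p}+\sum_{j\ge p}\frac1{\nu_j}$ for $p\ge1$, put $\sigma^N_0:=1$, $\sigma^N_p:=\frac{\tau_1p}{\tau_p}$ for $p\ge1$, and $S^N_p:=\prod_{i=0}^p\sigma^N_i$. For $M\in\mathbb{R}_{>0}^{\mathbb{N}}$, $h>0$: $\Lambda_{M,h}:=\{(a_p)_p\in\mathbb{C}^{\mathbb{N}}:\sup_p |a_p|/(h^pM_p)<+\infty\}$, $\Lambda_{\{M\}}:=\bigcup_{h>0}\Lambda_{M,h}$, $\Lambda_{(M)}:=\bigcap_{h>0}\Lambda_{M,h}$. $\mathcal{D}_{M,h}([-1,1])$ is the space of $f\in C^\infty(\mathbb{R},\mathbb{C})$ with $\operatorname{supp} f\subseteq[-1,1]$ and $\sup_{p\in\mathbb{N},x\in\mathbb{R}}|f^{(p)}(x)|/(h^pM_p)<+\infty$; $\mathcal{D}_{\{M\}}([-1,1]):=\bigcup_{h>0}\mathcal{D}_{M,h}([-1,1])$ and $\mathcal{D}_{(M)}([-1,1]):=\bigcap_{h>0}\mathcal{D}_{M,h}([-1,1])$.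 The Borel map is $\mathcal{B}(f):=(f^{(p)}(0))_{p\in\mathbb{N}}$. *)

(* Defs.v *)
From Stdlib Require Export Factorial List Reals RList Rtopology Rprod.
From Coquelicot Require Export Coquelicot.
Open Scope R_scope.

(** * Weight sequences *)

(* [x^(1/p)] for [x > 0] and [p >= 1]; the value at [p = 0] is junk and is only
   ever met inside a limit or limit inferior as [p] tends to infinity. *)
Definition nth_root (p : nat) (x : R) : R := Rpower x (/ INR p).

Definition positive (M : nat -> R) : Prop := forall p, 0 < M p.

Definition LC (N : nat -> R) : Prop :=
  positive N /\
  N 0%nat = 1 /\ N 0%nat <= N 1%nat /\
  (forall j, (1 <= j)%nat -> N j ^ 2 <= N (j - 1)%nat * N (j + 1)%nat) /\
  is_lim_seq (fun j => nth_root j (N j)) p_infty.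

Definition nu (N : nat -> R) (p : nat) : R :=
  match p with O => 1 | S q => N (S q) / N q end.

Definition nonquasianalytic (N : nat -> R) : Prop :=
  ex_series (fun k => / nu N (S k)).

(* [sum_(k >= p) 1 / nu_k]. *)
Definition tail (N : nat -> R) (p : nat) : R :=
  Series (fun k => / nu N (p + k)).

(* Suprema over [p >= 1] are shifted to sequences indexed from [0]. *)
Definition preceq (M N : nat -> R) : Prop :=
  has_ub (fun j => nth_root (S j) (M (S j) / N (S j))).

Definition equiv (M N : nat -> R) : Prop := preceq M N /\ preceq N M.

Definition preceq_maximal (A : (nat -> R) -> Prop) (K : nat -> R) : Prop :=
  A K /\ forall M, A M -> preceq M K.

Definition class_R (N M : nat -> R) : Prop :=
  positive M /\
  Rbar_lt 0 (LimInf_seq (fun p => nth_root p (M p / INR (fact p)))) /\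
  preceq M N.

Definition class_B (N M : nat -> R) : Prop :=
  positive M /\
  is_lim_seq (fun p => nth_root p (M p / INR (fact p))) p_infty /\
  preceq M N.

Definition class_LC_R (N M : nat -> R) : Prop := class_R N M /\ LC M.

Definition class_LC_B (N M : nat -> R) : Prop := class_B N M /\ LC M.

(** * The Schmets-Valdivia condition *)

(* For [p >= 1]: the supremum over [0 <= j < p] is a maximum. *)
Definition lambda (M N : nat -> R) (p s : nat) : R :=
  MaxRlist (map (fun j => nth_root (p - j) (M p / (INR s ^ p * N j))) (seq 0 p)).

Definition SV (M N : nat -> R) : Prop :=
  exists s : nat, (1 <= s)%nat /\
    has_ub (fun q => lambda M N (S q) s / INR (S q) * tail N (S q)).

(** * The sequences [L^s] and the descendant *)

Definition Lseq (N : nat -> R) (s p : nat) : R :=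
  match p with
  | O => 1
  | S _ =>
      INR s ^ p *
      MinRlist (map (fun j => (INR p / tail N p) ^ (p - j) * N j) (seq 0 p))
  end.

Definition tau (N : nat -> R) (p : nat) : R := INR p / nu N p + tail N p.

Definition sigma (N : nat -> R) (p : nat) : R :=
  match p with O => 1 | S _ => tau N 1 * INR p / tau N p end.

Definition descendant (N : nat -> R) (p : nat) : R := prod_f_R0 (sigma N) p.

(** * Sequence spaces, ultradifferentiable functions and the Borel map *)

Definition Lambda (M : nat -> R) (h : R) (a : nat -> C) : Prop :=
  has_ub (fun p => Cmod (a p) / (h ^ p * M p)).

Definition Lambda_R (M : nat -> R) (a : nat -> C) : Prop :=
  exists h, 0 < h /\ Lambda M h a.

Definition Lambda_B (M : nat -> R) (a : nat -> C) : Prop :=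
  forall h, 0 < h -> Lambda M h a.

(* Coquelicot's iterated derivative is real-valued: complex-valued functions of
   a real variable are differentiated componentwise. *)
Definition smooth (f : R -> C) : Prop :=
  forall p x, ex_derive_n (fun t => Re (f t)) p x /\
              ex_derive_n (fun t => Im (f t)) p x.

Definition CDerive_n (f : R -> C) (p : nat) (x : R) : C :=
  (Derive_n (fun t => Re (f t)) p x, Derive_n (fun t => Im (f t)) p x).

Definition support (f : R -> C) : R -> Prop :=
  adherence (fun x => f x <> RtoC 0).

Definition D (M : nat -> R) (h : R) (f : R -> C) : Prop :=
  smooth f /\
  included (support f) (fun x => -1 <= x <= 1) /\
  bound (fun y => exists (p : nat) (x : R),
                    y = Cmod (CDerive_n f p x) / (h ^ p * M p)).

Definition D_R (M : nat -> R) (f : R -> C) : Prop :=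
  exists h, 0 < h /\ D M h f.

Definition D_B (M : nat -> R) (f : R -> C) : Prop :=
  forall h, 0 < h -> D M h f.

Definition Borel (f : R -> C) : nat -> C := fun p => CDerive_n f p 0.

(* The inclusion of [A] in the image of [E] under the Borel map. *)
Definition Borel_covers (E : (R -> C) -> Prop) (A : (nat -> C) -> Prop) : Prop :=
  forall a, A a -> exists f, E f /\ forall p, Borel f p = a p.

(* Main.v *)
Require Import Defs.
From Stdlib Require Import Compare_dec Lra Lia Psatz Classical ClassicalEpsilon.

(** Write [t_p] for the tail [sum_(k >= p) 1 / nu_k] and [S] for the descendant.
    The hypothesis amounts to [p / nu_p <= c * t_(2p)].  It makes [tau_p]
    comparable to [t_p] and the quotients [t_p / t_(p+1)] at most [1 + c / p],
    and from this one obtains, up to geometric factors,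
    [(p / t_p)^p <= S_p <= (p / t_p)^(p-j) N_j] for all [j <= p]
    ([tail_pow_le_descendant], [descendant_le]).  The upper bound says that [S]
    is dominated by every [L^s] and satisfies the condition [SV]; the lower
    bound, compared with the term [j = 0] in the definition of [L^s] or of
    [lambda], gives the other half of (i) and the maximality in (ii).

    In (iii), optimality rests on Bang's estimate for flat functions
    ([bang_flat]): if all derivatives of a function up to a high order vanish at
    [0], then the function is still tiny at a distance comparable to a sum of
    quotients [1 / nu_j].  Suppose that [M] is not dominated by [S].  A lacunary
    sequence [a] can be chosen in the space of [M] although its nonzero terms
    [a_p] eventually exceed [q^p S_p] for every [q].  If [a] is the Borel image
    of [f], then [f^(p) - a_p] is flat up to the order of the next gap, so
    [f^(p)] stays above [a_p / 2] on an interval of length comparable to [t_p],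
    and integrating [p] times yields [a_p <= d^p (p / t_p)^p]
    ([coefficient_bound]), which contradicts the lower bound on [S_p].

    For the inclusions, the function with Borel image [a] is
    [sum_p a_p x^p / p! * chi_p].  The cutoff function [chi_p] comes from
    smoothing a trapezoid by infinitely many averages: [p] of them of width
    [d_p t_p / p], then one of width [d_j / nu_j] for every [j > p]
    ([cutoff], [width]).  Its support has radius comparable to [d_p t_p], and
    each derivative costs the inverse of one width.  By the upper bound on [S]
    the [n]-th derivative of [x^p / p! * chi_p], multiplied by [S_p], is at most
    [K^p d_p^p k^n N_n / (d_1 ... d_n)] ([block_exists]).  For the union of the spaces a small constant [d] gives convergence.  For the
    intersection the [d_j] have to tend to infinity, slowly enough for the
    widths to stay summable and for the series to converge; both constraints
    leave room because [t_p] tends to [0] ([greedy_stretch_lim]). *)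

(** * Roots and comparison of sequences *)

Lemma pow_lt_compat_l (x y : R) (p : nat) :
  (1 <= p)%nat -> 0 <= x < y -> x ^ p < y ^ p.
Proof.
  intros Hp Hxy. destruct p as [|p]; [lia|]. clear Hp.
  induction p as [|p IH]; [simpl; lra|].
  rewrite <- (tech_pow_Rmult x), <- (tech_pow_Rmult y).
  apply Rmult_le_0_lt_compat; try lra. apply pow_le; lra.
Qed.

Lemma nth_root_pos (p : nat) (x : R) : 0 < nth_root p x.
Proof. apply exp_pos. Qed.

Lemma nth_root_pow (p : nat) (x : R) :
  (1 <= p)%nat -> 0 < x -> nth_root p x ^ p = x.
Proof.
  intros Hp Hx. unfold nth_root.
  rewrite <- Rpower_pow by apply exp_pos.
  rewrite Rpower_mult, Rinv_l, Rpower_1; auto.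
  apply not_0_INR; lia.
Qed.

Lemma nth_root_le (p : nat) (x c : R) :
  (1 <= p)%nat -> 0 < x -> 0 <= c -> nth_root p x <= c <-> x <= c ^ p.
Proof.
  intros Hp Hx Hc. pose proof (nth_root_pos p x) as H0.
  split; intros H.
  - rewrite <- (nth_root_pow p x) by assumption. apply pow_incr; lra.
  - apply Rnot_lt_le; intros Hlt.
    pose proof (pow_lt_compat_l c _ p Hp (conj Hc Hlt)) as Hpow.
    rewrite (nth_root_pow p x) in Hpow by assumption. lra.
Qed.

Lemma nth_root_lt (p : nat) (x c : R) :
  (1 <= p)%nat -> 0 < x -> 0 <= c -> c < nth_root p x <-> c ^ p < x.
Proof.
  intros Hp Hx Hc. pose proof (nth_root_le p x c Hp Hx Hc) as H.
  split; intros H1; apply Rnot_le_lt; intros H2; apply H in H2; lra.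
Qed.

Lemma preceq_iff (M N : nat -> R) :
  positive M -> positive N ->
  preceq M N <-> exists c, 0 < c /\ forall p, (1 <= p)%nat -> M p <= c ^ p * N p.
Proof.
  intros HM HN.
  assert (Hq : forall p, 0 < M p / N p).
  { intros p. apply Rdiv_lt_0_compat; [apply HM|apply HN]. }
  split.
  - intros [c Hc]. exists c. split.
    + eapply Rlt_le_trans; [apply (nth_root_pos 1 (M 1%nat / N 1%nat))|].
      apply Hc. exists 0%nat. reflexivity.
    + intros [|p] Hp; [lia|].
      assert (H : nth_root (S p) (M (S p) / N (S p)) <= c).
      { apply Hc. exists p. reflexivity. }
      assert (H0 : 0 <= c).
      { eapply Rle_trans; [|exact H]. left; apply nth_root_pos. }
      apply nth_root_le in H; auto; try lia.
      apply Rmult_le_reg_r with (/ N (S p)).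
      { apply Rinv_0_lt_compat, HN. }
      rewrite Rmult_assoc, Rinv_r, Rmult_1_r; [exact H|].
      apply Rgt_not_eq, HN.
  - intros [c [Hc0 Hc]]. exists c. intros y [p ->].
    apply nth_root_le; auto; try lra; try lia.
    specialize (Hc (S p) ltac:(lia)).
    apply Rmult_le_reg_r with (N (S p)); [apply HN|].
    unfold Rdiv. rewrite Rmult_assoc, Rinv_l, Rmult_1_r; [exact Hc|].
    apply Rgt_not_eq, HN.
Qed.

Lemma quotient_root_lim (b : nat -> R) :
  positive b -> (forall c, 0 < c -> eventually (fun p => c * b p <= b (S p))) ->
  is_lim_seq (fun p => nth_root p (b p)) p_infty.
Proof.
  intros Hb Hq. apply is_lim_seq_spec. intros y.
  set (c := Rmax y 0 + 1).
  assert (Hc : 1 <= c) by (unfold c; pose proof (Rmax_r y 0); lra).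
  assert (Hcy : y < c) by (unfold c; pose proof (Rmax_l y 0); lra).
  destruct (Hq (2 * c) ltac:(lra)) as [P HP].
  assert (Hgrow : forall k, (2 * c) ^ k * b P <= b (P + k)%nat).
  { induction k as [|k IH]; [rewrite Nat.add_0_r; simpl; lra|].
    rewrite Nat.add_succ_r.
    eapply Rle_trans; [|apply (HP (P + k)%nat); lia].
    simpl. apply (Rmult_le_compat_l (2 * c)) in IH; lra. }
  destruct (Pow_x_infinity 2 ltac:(rewrite Rabs_pos_eq; lra) (2 * c ^ P / b P))
    as [K HK].
  exists (P + K + 1)%nat. intros p Hp.
  apply Rlt_trans with c; [exact Hcy|].
  apply nth_root_lt; try apply Hb; try lra; try lia.
  replace p with (P + (p - P))%nat by lia. set (k := (p - P)%nat).
  eapply Rlt_le_trans; [|apply Hgrow].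
  specialize (HK k ltac:(unfold k; lia)).
  rewrite Rabs_pos_eq in HK by (apply pow_le; lra).
  apply Rge_le in HK.
  assert (HbP := Hb P).
  apply (Rmult_le_compat_r (b P)) in HK; [|lra].
  unfold Rdiv in HK. rewrite Rmult_assoc, Rinv_l, Rmult_1_r in HK by lra.
  rewrite pow_add, Rpow_mult_distr.
  assert (Hck : 0 < c ^ k) by (apply pow_lt; lra).
  assert (HcP : 0 < c ^ P) by (apply pow_lt; lra).
  nra.
Qed.

(** * Weights whose tails decrease moderately *)

(** The positive lower limit in the theorem is turned into the inequality
    [p / nu_p <= c * t_(2p)] for the tails [t_p], with one constant for all
    [p]: finitely many indices only enlarge [c]. *)
Record moderate (N : nat -> R) (c : R) : Prop := {
  weight_pos : positive N;
  weight_0 : N 0%nat = 1;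
  nu_mono : forall p q, (p <= q)%nat -> nu N p <= nu N q;
  tail_pos : forall p, 0 < tail N p;
  tail_S : forall p, tail N p = / nu N p + tail N (S p);
  tail_lim : is_lim_seq (tail N) 0;
  const_pos : 0 < c;
  nu_tail : forall p, INR p / nu N p <= c * tail N (2 * p) }.

Lemma nu_pos (N : nat -> R) : positive N -> forall p, 0 < nu N p.
Proof.
  intros HN [|p]; simpl; [lra|]. apply Rdiv_lt_0_compat; apply HN.
Qed.

Lemma ex_finite_bound (f : nat -> R) (n : nat) :
  exists c, 0 < c /\ forall p, (p <= n)%nat -> f p <= c.
Proof.
  induction n as [|n [c [Hc IH]]].
  - exists (Rmax (f 0%nat) 1). split.
    + pose proof (Rmax_r (f 0%nat) 1); lra.
    + intros p Hp. replace p with 0%nat by lia. apply Rmax_l.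
  - exists (Rmax (f (S n)) c). split.
    + pose proof (Rmax_r (f (S n)) c); lra.
    + intros p Hp. destruct (Nat.eq_dec p (S n)) as [->|Hne]; [apply Rmax_l|].
      eapply Rle_trans; [apply IH; lia|apply Rmax_r].
Qed.

Lemma LimInf_seq_pos (u : nat -> R) :
  Rbar_lt 0 (LimInf_seq u) -> exists e, 0 < e /\ eventually (fun p => e <= u p).
Proof.
  unfold LimInf_seq. destruct (ex_LimInf_seq u) as [[l| |] Hl]; simpl; intros H.
  - destruct (Hl (mkposreal (l / 2) ltac:(lra))) as [_ [P HP]]. simpl in HP.
    exists (l / 2). split; [lra|]. exists P. intros p Hp.
    specialize (HP p Hp). lra.
  - destruct (Hl 1) as [P HP]. exists 1. split; [lra|].
    exists P. intros p Hp. specialize (HP p Hp). lra.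
  - contradiction.
Qed.

Lemma moderate_intro (N : nat -> R) :
  LC N -> nonquasianalytic N ->
  Rbar_lt 0 (LimInf_seq (fun p => nu N p / INR p * tail N (2 * p))) ->
  exists c, moderate N c.
Proof.
  intros [HN [HN0 [HN1 [Hlc _]]]] Hnqa Hinf.
  assert (Hnu := nu_pos N HN).
  assert (Hmono : forall p, nu N p <= nu N (S p)).
  { intros [|p].
    - simpl. rewrite HN0 in *. lra.
    - specialize (Hlc (S p) ltac:(lia)). simpl in Hlc.
      rewrite Nat.sub_0_r, Nat.add_1_r in Hlc. simpl.
      pose proof (HN p); pose proof (HN (S p)); pose proof (HN (S (S p))).
      apply Rmult_le_reg_r with (N p * N (S p)); [nra|]. field_simplify; nra. }
  assert (Hex : forall p, ex_series (fun k => / nu N (p + k))).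
  { intros p. apply (ex_series_incr_n (fun k => / nu N k)).
    apply ex_series_incr_1. exact Hnqa. }
  assert (HtS : forall p, tail N p = / nu N p + tail N (S p)).
  { intros p. unfold tail. rewrite Series_incr_1 by apply Hex.
    rewrite Nat.add_0_r. f_equal. apply Series_ext. intros k.
    rewrite Nat.add_succ_r. reflexivity. }
  assert (Ht0 : forall p, 0 <= tail N p).
  { intros p. unfold tail.
    replace 0 with (0 * Series (fun k => / nu N (p + k))) by ring.
    rewrite <- Series_scal_l. apply Series_le; [|apply Hex].
    intros k. rewrite Rmult_0_l. split; [lra|].
    left. apply Rinv_0_lt_compat, Hnu. }
  assert (Ht : forall p, 0 < tail N p).
  { intros p. rewrite HtS. pose proof (Ht0 (S p)).
    pose proof (Rinv_0_lt_compat _ (Hnu p)). lra. }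
  destruct (LimInf_seq_pos _ Hinf) as [e [He [P HP]]].
  destruct (ex_finite_bound (fun p => INR p / nu N p / tail N (2 * p)) P)
    as [d [Hd Hfin]].
  exists (Rmax d (/ e)). split; auto.
  - intros p q Hpq. induction Hpq; [lra|]. eapply Rle_trans; [|apply Hmono]; auto.
  - set (s := Series (fun k => / nu N k)).
    apply is_lim_seq_incr_1.
    apply is_lim_seq_ext with (fun n => s - sum_n (fun k => / nu N k) n).
    { intros n. unfold s. rewrite (Series_incr_n _ (S n)); [|lia|apply (Hex 0%nat)].
      rewrite sum_n_Reals. unfold tail. simpl pred. ring. }
    replace 0 with (s - s) by ring.
    apply is_lim_seq_minus'; [apply is_lim_seq_const|].
    apply (Series_correct _ (Hex 0%nat)).
  - eapply Rlt_le_trans; [exact Hd|apply Rmax_l].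
  - intros p.
    destruct (le_lt_dec p P) as [Hp|Hp].
    + specialize (Hfin p Hp). simpl in Hfin.
      apply Rle_trans with (d * tail N (2 * p)).
      * apply (Rmult_le_compat_r (tail N (2 * p))) in Hfin; [|apply Ht0].
        simpl in *. unfold Rdiv at 1 in Hfin. rewrite Rmult_assoc, Rinv_l in Hfin.
        lra. apply Rgt_not_eq, (Ht (2 * p)%nat).
      * apply Rmult_le_compat_r; [apply Ht0|apply Rmax_l].
    + apply Rle_trans with (/ e * tail N (2 * p)).
      2: { apply Rmult_le_compat_r; [apply Ht0|apply Rmax_r]. }
      specialize (HP p ltac:(lia)).
      assert (0 < INR p) by (apply lt_0_INR; lia).
      specialize (Hnu p).
      apply Rmult_le_reg_r with (e * nu N p / INR p).
      { apply Rdiv_lt_0_compat; [apply Rmult_lt_0_compat; assumption|assumption]. }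
      apply Rle_trans with e; [right; field; lra|].
      eapply Rle_trans; [exact HP|]. right. field. lra.
Qed.

(** * The descendant *)

Lemma tail_mono (N : nat -> R) (c : R) : moderate N c ->
  forall p q, (p <= q)%nat -> tail N q <= tail N p.
Proof.
  intros HN p q Hpq. induction Hpq as [|q Hpq IH]; [lra|].
  rewrite (tail_S N c HN q) in IH.
  pose proof (Rinv_0_lt_compat _ (nu_pos N (weight_pos N c HN) q)). lra.
Qed.

Lemma tail_le_block (N : nat -> R) (c : R) : moderate N c ->
  forall p k, tail N p <= INR k * / nu N p + tail N (p + k).
Proof.
  intros HN p k. induction k as [|k IH].
  - rewrite Nat.add_0_r. simpl. lra.
  - rewrite (tail_S N c HN (p + k)) in IH. rewrite Nat.add_succ_r, S_INR.
    assert (H : / nu N (p + k) <= / nu N p).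
    { apply Rinv_le_contravar; [apply nu_pos, (weight_pos N c HN)|].
      apply (nu_mono N c HN); lia. }
    lra.
Qed.

Lemma tail_double (N : nat -> R) (c : R) : moderate N c ->
  forall p, tail N p <= (1 + c) * tail N (2 * p).
Proof.
  intros HN p. pose proof (tail_le_block N c HN p p) as H.
  pose proof (nu_tail N c HN p) as H1. unfold Rdiv in H1.
  replace (p + p)%nat with (2 * p)%nat in H by lia. lra.
Qed.

Lemma inv_nu_le (N : nat -> R) (c : R) : moderate N c ->
  forall p, (1 <= p)%nat -> / nu N p <= c * tail N (S p) / INR p.
Proof.
  intros HN p Hp.
  assert (Hp0 : 0 < INR p) by (apply lt_0_INR; lia).
  pose proof (nu_tail N c HN p) as H.
  pose proof (tail_mono N c HN (S p) (2 * p) ltac:(lia)) as H1.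
  pose proof (const_pos N c HN) as Hc.
  apply Rmult_le_reg_l with (INR p); [exact Hp0|].
  apply Rle_trans with (c * tail N (S p)); [|right; field; lra].
  unfold Rdiv in H. nra.
Qed.

Lemma tau_le_tail (N : nat -> R) (c : R) : moderate N c ->
  forall p, tail N p <= tau N p <= (1 + c) * tail N p.
Proof.
  intros HN p. unfold tau.
  pose proof (nu_tail N c HN p) as H.
  pose proof (tail_mono N c HN p (2 * p) ltac:(lia)) as H1.
  pose proof (const_pos N c HN) as Hc.
  assert (H0 : 0 <= INR p / nu N p).
  { apply Rdiv_le_0_compat; [apply pos_INR|apply nu_pos, (weight_pos N c HN)]. }
  split; nra.
Qed.

Lemma tau_pos (N : nat -> R) (c : R) : moderate N c -> forall p, 0 < tau N p.
Proof.
  intros HN p. pose proof (tau_le_tail N c HN p). pose proof (tail_pos N c HN p).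
  lra.
Qed.

(** The descendant is built so that its quotients increase: [tau_p / p] is the
    sum of the decreasing quantities [1 / nu_p] and [t_p / p]. *)
Lemma div_tau_mono (N : nat -> R) (c : R) : moderate N c ->
  forall p q, (p <= q)%nat -> INR p / tau N p <= INR q / tau N q.
Proof.
  intros HN p q Hpq.
  pose proof (tau_pos N c HN p) as Hp. pose proof (tau_pos N c HN q) as Hq.
  assert (Hpq' : INR p <= INR q) by (apply le_INR; exact Hpq).
  assert (H0 : 0 <= INR p) by apply pos_INR.
  assert (H : INR p * tau N q <= INR q * tau N p).
  { unfold tau.
    pose proof (tail_mono N c HN p q Hpq) as Ht.
    pose proof (tail_pos N c HN q).
    assert (Hnu : / nu N q <= / nu N p).
    { apply Rinv_le_contravar; [apply nu_pos, (weight_pos N c HN)|].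
      apply (nu_mono N c HN); exact Hpq. }
    unfold Rdiv.
    assert (INR p * INR q * / nu N q <= INR p * INR q * / nu N p).
    { apply Rmult_le_compat_l; [nra|exact Hnu]. }
    nra. }
  apply Rmult_le_reg_r with (tau N p * tau N q); [nra|].
  field_simplify; lra.
Qed.

Lemma sigma_S (N : nat -> R) (p : nat) :
  sigma N (S p) = tau N 1 * (INR (S p) / tau N (S p)).
Proof. unfold sigma, Rdiv. ring. Qed.

Lemma sigma_pos (N : nat -> R) (c : R) : moderate N c -> positive (sigma N).
Proof.
  intros HN [|p]; [simpl; lra|]. rewrite sigma_S.
  pose proof (tau_pos N c HN 1). pose proof (tau_pos N c HN (S p)).
  apply Rmult_lt_0_compat; [assumption|].
  apply Rdiv_lt_0_compat; [apply lt_0_INR; lia|assumption].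
Qed.

Lemma descendant_S (N : nat -> R) (p : nat) :
  descendant N (S p) = descendant N p * sigma N (S p).
Proof. reflexivity. Qed.

Lemma descendant_pos (N : nat -> R) (c : R) :
  moderate N c -> positive (descendant N).
Proof.
  intros HN p. induction p as [|p IH]; [unfold descendant; simpl; lra|].
  rewrite descendant_S. apply Rmult_lt_0_compat; [exact IH|].
  apply (sigma_pos N c HN).
Qed.

Lemma weight_S (N : nat -> R) (p : nat) :
  positive N -> N (S p) = N p * nu N (S p).
Proof. intros HN. simpl. field. apply Rgt_not_eq, HN. Qed.

(** The upper half of the comparison with [L^s]: the first [j] quotients of the
    descendant are at most [tau_1 * nu_i], the others at most
    [tau_1 * p / t_p] by monotonicity. *)
Lemma descendant_le (N : nat -> R) (c : R) : moderate N c ->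
  forall p j, (j <= p)%nat ->
  descendant N p <= tau N 1 ^ p * ((INR p / tail N p) ^ (p - j) * N j).
Proof.
  intros HN p j Hj.
  assert (HN0 := weight_pos N c HN).
  assert (Ht1 := tau_pos N c HN 1).
  assert (Htp := tail_pos N c HN p).
  assert (Hlow : forall i, descendant N i <= tau N 1 ^ i * N i).
  { induction i as [|i IH].
    - rewrite (weight_0 N c HN). unfold descendant. simpl. lra.
    - rewrite descendant_S, (weight_S N i HN0). simpl pow.
      replace (tau N 1 * tau N 1 ^ i * (N i * nu N (S i))) with
        ((tau N 1 ^ i * N i) * (tau N 1 * nu N (S i))) by ring.
      apply Rmult_le_compat; [left; apply (descendant_pos N c HN)|
        left; apply (sigma_pos N c HN)|exact IH|].
      rewrite sigma_S. apply Rmult_le_compat_l; [lra|].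
      pose proof (tau_pos N c HN (S i)) as Hti.
      pose proof (nu_pos N HN0 (S i)) as Hnu.
      apply Rmult_le_reg_r with (tau N (S i) / nu N (S i)).
      { apply Rdiv_lt_0_compat; assumption. }
      apply Rle_trans with (INR (S i) / nu N (S i)); [right; field; lra|].
      apply Rle_trans with (tau N (S i)); [|right; field; lra].
      unfold tau at 1. pose proof (tail_pos N c HN (S i)). lra. }
  assert (Hhigh : forall k, (j + k <= p)%nat ->
     descendant N (j + k) <= descendant N j * (tau N 1 * (INR p / tail N p)) ^ k).
  { induction k as [|k IH]; intros Hk.
    - rewrite Nat.add_0_r. simpl. lra.
    - rewrite Nat.add_succ_r, descendant_S. simpl pow.
      rewrite (Rmult_comm (tau N 1 * _) (_ ^ k)), <- Rmult_assoc.
      apply Rmult_le_compat; [left; apply (descendant_pos N c HN)|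
        left; apply (sigma_pos N c HN)|apply IH; lia|].
      rewrite sigma_S. apply Rmult_le_compat_l; [lra|].
      eapply Rle_trans; [apply (div_tau_mono N c HN _ p); lia|].
      apply Rmult_le_compat_l; [apply pos_INR|].
      apply Rinv_le_contravar; [exact Htp|apply (tau_le_tail N c HN)]. }
  specialize (Hhigh (p - j)%nat ltac:(lia)).
  replace (j + (p - j))%nat with p in Hhigh by lia.
  eapply Rle_trans; [exact Hhigh|].
  apply Rle_trans with ((tau N 1 ^ j * N j) * (tau N 1 * (INR p / tail N p)) ^ (p - j)).
  { apply Rmult_le_compat_r; [|apply Hlow]. apply pow_le.
    apply Rmult_le_pos; [lra|]. apply Rdiv_le_0_compat; [apply pos_INR|lra]. }
  rewrite Rpow_mult_distr.
  replace (tau N 1 ^ p) with (tau N 1 ^ j * tau N 1 ^ (p - j)).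
  2: { rewrite <- pow_add. f_equal; lia. }
  right; ring.
Qed.

Lemma pow_one_plus_div_le (x : R) (p : nat) :
  0 <= x -> (1 <= p)%nat -> (1 + x / INR p) ^ p <= exp x.
Proof.
  intros Hx Hp. assert (Hp0 : 0 < INR p) by (apply lt_0_INR; lia).
  apply Rle_trans with (exp (x / INR p) ^ p).
  - apply pow_incr. split; [|apply exp_ineq1_le].
    assert (0 <= x / INR p) by (apply Rdiv_le_0_compat; lra). lra.
  - rewrite <- Rpower_pow by apply exp_pos. unfold Rpower. rewrite ln_exp.
    right. f_equal. field. lra.
Qed.

(** The lower half: a single step of the left-hand side multiplies it by at
    most [e * e^c * (p+1) / t_(p+1)], because [t_p <= (1 + c/p) t_(p+1)]; this
    is a quotient of the descendant up to a constant. *)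
Lemma tail_pow_le_descendant (N : nat -> R) (c : R) : moderate N c ->
  exists d, 0 < d /\
  forall p, (1 <= p)%nat -> (INR p / tail N p) ^ p <= d ^ p * descendant N p.
Proof.
  intros HN.
  assert (Ht1 := tau_pos N c HN 1).
  assert (Hc := const_pos N c HN).
  set (d := exp 1 * exp c * (1 + c) / tau N 1).
  assert (He := exp_pos 1). assert (Hec := exp_pos c).
  assert (Hd : 0 < d).
  { unfold d. apply Rdiv_lt_0_compat; [|exact Ht1].
    apply Rmult_lt_0_compat; [|lra]. apply Rmult_lt_0_compat; assumption. }
  assert (Hd1 : (1 + c) / tau N 1 <= d).
  { unfold d, Rdiv. apply Rmult_le_compat_r; [left; apply Rinv_0_lt_compat, Ht1|].
    assert (1 <= exp 1 * exp c).
    { rewrite <- exp_plus. pose proof (exp_ineq1_le (1 + c)). lra. }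
    nra. }
  assert (Hsig : forall p, INR (S p) / tail N (S p) <=
                           (1 + c) / tau N 1 * sigma N (S p)).
  { intros p. rewrite sigma_S.
    pose proof (tau_pos N c HN (S p)) as Htp.
    pose proof (tail_pos N c HN (S p)) as Htl.
    apply Rle_trans with (INR (S p) * ((1 + c) / tau N (S p))); [|right; field; lra].
    apply Rmult_le_compat_l; [apply pos_INR|].
    apply Rmult_le_reg_r with (tail N (S p) * tau N (S p)); [nra|].
    field_simplify; try lra. pose proof (tau_le_tail N c HN (S p)). lra. }
  exists d. split; [exact Hd|].
  intros p Hp. destruct p as [|p]; [lia|]. clear Hp.
  induction p as [|p IH].
  - rewrite !pow_1, descendant_S.
    replace (descendant N 0) with 1 by (unfold descendant; reflexivity).
    rewrite Rmult_1_l. eapply Rle_trans; [apply Hsig|].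
    apply Rmult_le_compat_r; [left; apply (sigma_pos N c HN)|exact Hd1].
  - set (q := S p) in *.
    assert (Hq0 : 0 < INR q) by (apply lt_0_INR; unfold q; lia).
    assert (Htq := tail_pos N c HN q). assert (HtSq := tail_pos N c HN (S q)).
    assert (Hstep : INR (S q) / tail N (S q) <=
                    (1 + 1 / INR q) * (1 + c / INR q) * (INR q / tail N q)).
    { pose proof (inv_nu_le N c HN q ltac:(unfold q; lia)) as Hnu.
      pose proof (tail_S N c HN q) as HS.
      assert (Htt : tail N q <= (1 + c / INR q) * tail N (S q)).
      { rewrite HS. unfold Rdiv in *. nra. }
      rewrite S_INR.
      apply Rmult_le_reg_r with (tail N q * tail N (S q)); [nra|].
      replace ((INR q + 1) / tail N (S q) * (tail N q * tail N (S q)))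
        with ((INR q + 1) * tail N q) by (field; lra).
      replace ((1 + 1 / INR q) * (1 + c / INR q) * (INR q / tail N q) *
               (tail N q * tail N (S q)))
        with ((INR q + 1) * ((1 + c / INR q) * tail N (S q))) by (field; lra).
      apply Rmult_le_compat_l; lra. }
    rewrite <- tech_pow_Rmult, <- (tech_pow_Rmult d), descendant_S.
    assert (H1 : (INR (S q) / tail N (S q)) ^ q <=
                 exp 1 * exp c * (d ^ q * descendant N q)).
    { eapply Rle_trans.
      { apply pow_incr. split; [|exact Hstep].
        apply Rdiv_le_0_compat; [apply pos_INR|exact HtSq]. }
      rewrite !Rpow_mult_distr.
      assert (Ha : forall x, 0 <= x -> 0 <= (1 + x / INR q) ^ q <= exp x).
      { intros x Hx. split; [|apply pow_one_plus_div_le; [exact Hx|unfold q; lia]].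
        apply pow_le. assert (0 <= x / INR q) by (apply Rdiv_le_0_compat; lra). lra. }
      apply Rmult_le_compat.
      - apply Rmult_le_pos; apply Ha; lra.
      - apply pow_le, Rdiv_le_0_compat; lra.
      - apply Rmult_le_compat; apply Ha; lra.
      - exact IH. }
    pose proof (Hsig q) as H2.
    apply Rle_trans with (((1 + c) / tau N 1 * sigma N (S q)) *
                          (exp 1 * exp c * (d ^ q * descendant N q))).
    { apply Rmult_le_compat; [|apply pow_le|exact H2|exact H1];
        apply Rdiv_le_0_compat; try apply pos_INR; exact HtSq. }
    right. unfold d at 2. field. lra.
Qed.

Lemma descendant_lim (N : nat -> R) (c : R) : moderate N c ->
  is_lim_seq (fun p => nth_root p (descendant N p / INR (fact p))) p_infty.
Proof.
  intros HN. apply (quotient_root_lim (fun p => descendant N p / INR (fact p))).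
  { intros p. apply Rdiv_lt_0_compat; [apply (descendant_pos N c HN)|].
    apply INR_fact_lt_0. }
  intros y Hy.
  assert (Ht1 := tau_pos N c HN 1). assert (Hc := const_pos N c HN).
  pose proof (tail_lim N c HN) as Hlim. apply is_lim_seq_spec in Hlim.
  assert (He : 0 < tau N 1 / (y * (1 + c))).
  { apply Rdiv_lt_0_compat; [exact Ht1|]. apply Rmult_lt_0_compat; lra. }
  destruct (Hlim (mkposreal _ He)) as [P HP]. simpl in HP.
  exists P. intros p Hp. specialize (HP (S p) ltac:(lia)).
  rewrite Rminus_0_r, Rabs_pos_eq in HP by (left; apply (tail_pos N c HN)).
  rewrite descendant_S, sigma_S, fact_simpl, mult_INR.
  pose proof (tau_pos N c HN (S p)) as Htp.
  pose proof (INR_fact_lt_0 p) as Hf.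
  assert (HSp : 0 < INR (S p)) by (apply lt_0_INR; lia).
  replace (descendant N p * (tau N 1 * (INR (S p) / tau N (S p))) /
     (INR (S p) * INR (fact p))) with
     (tau N 1 / tau N (S p) * (descendant N p / INR (fact p))) by (field; lra).
  apply Rmult_le_compat_r.
  { left. apply Rdiv_lt_0_compat; [apply (descendant_pos N c HN)|exact Hf]. }
  apply Rmult_le_reg_r with (tau N (S p)); [exact Htp|].
  replace (tau N 1 / tau N (S p) * tau N (S p)) with (tau N 1) by (field; lra).
  apply Rmult_lt_compat_r with (r := y * (1 + c)) in HP;
    [|apply Rmult_lt_0_compat; lra].
  replace (tau N 1 / (y * (1 + c)) * (y * (1 + c))) with (tau N 1) in HP
    by (field; lra).
  pose proof (tau_le_tail N c HN (S p)). nra.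
Qed.

Lemma descendant_LC (N : nat -> R) (c : R) : moderate N c -> LC (descendant N).
Proof.
  intros HN. assert (Hpos := descendant_pos N c HN).
  assert (Ht1 := tau_pos N c HN 1).
  assert (Hmono : forall p, sigma N (S p) <= sigma N (S (S p))).
  { intros p. rewrite !sigma_S. apply Rmult_le_compat_l; [lra|].
    apply (div_tau_mono N c HN). lia. }
  assert (H0 : descendant N 0 = 1) by reflexivity.
  split; [exact Hpos|]. split; [exact H0|]. split; [|split].
  - rewrite descendant_S, H0, sigma_S. simpl. right. field. lra.
  - intros [|j] Hj; [lia|]. simpl. rewrite Nat.sub_0_r, Nat.add_1_r, Rmult_1_r.
    rewrite !descendant_S.
    pose proof (Hpos j). pose proof (sigma_pos N c HN (S j)).
    specialize (Hmono j).
    replace (descendant N j * sigma N (S j) * (descendant N j * sigma N (S j)))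
      with (descendant N j * descendant N j * sigma N (S j) * sigma N (S j)) by ring.
    replace (descendant N j * (descendant N j * sigma N (S j) * sigma N (S (S j))))
      with (descendant N j * descendant N j * sigma N (S j) * sigma N (S (S j)))
      by ring.
    apply Rmult_le_compat_l; [|exact Hmono]. nra.
  - eapply is_lim_seq_le_p_loc; [|apply (descendant_lim N c HN)].
    exists 1%nat. intros p Hp.
    pose proof (Hpos p) as Hp0. pose proof (INR_fact_lt_0 p) as Hf.
    assert (Hq : 0 < descendant N p / INR (fact p)) by (apply Rdiv_lt_0_compat; auto).
    apply nth_root_le; auto; [left; apply nth_root_pos|].
    rewrite nth_root_pow by auto.
    assert (1 <= INR (fact p)).
    { change 1 with (INR 1). apply le_INR. apply lt_O_fact. }
    apply Rmult_le_reg_r with (INR (fact p)); [exact Hf|].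
    replace (descendant N p / INR (fact p) * INR (fact p)) with (descendant N p)
      by (field; lra). nra.
Qed.

Lemma descendant_preceq (N : nat -> R) (c : R) :
  moderate N c -> preceq (descendant N) N.
Proof.
  intros HN. apply preceq_iff.
  - apply (descendant_pos N c HN).
  - apply (weight_pos N c HN).
  - exists (tau N 1). split; [apply (tau_pos N c HN)|].
    intros p Hp. pose proof (descendant_le N c HN p p (Nat.le_refl p)) as H.
    rewrite Nat.sub_diag in H. simpl in H. lra.
Qed.

Lemma descendant_class_B (N : nat -> R) (c : R) :
  moderate N c -> class_B N (descendant N).
Proof.
  intros HN. split; [apply (descendant_pos N c HN)|].
  split; [apply (descendant_lim N c HN)|apply (descendant_preceq N c HN)].
Qed.

Lemma class_B_R (N M : nat -> R) : class_B N M -> class_R N M.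
Proof.
  intros [H1 [H2 H3]]. split; [exact H1|]. split; [|exact H3].
  rewrite (is_LimInf_seq_unique _ p_infty); [exact I|].
  apply is_lim_LimInf_seq. exact H2.
Qed.

(** * The condition of Schmets and Valdivia and the sequences [L^s] *)

Lemma le_MinRlist (l : list R) (b : R) :
  l <> nil -> (forall y, In y l -> b <= y) -> b <= MinRlist l.
Proof.
  induction l as [|x [|y l] IH]; intros Hl Hb; [congruence| |].
  - apply Hb. left; reflexivity.
  - change (b <= Rmin x (MinRlist (y :: l))). apply Rmin_glb.
    + apply Hb. left; reflexivity.
    + apply IH; [congruence|]. intros z Hz. apply Hb. right; exact Hz.
Qed.

Lemma Lseq_pos (N : nat -> R) (c : R) (s : nat) :
  moderate N c -> (1 <= s)%nat -> positive (Lseq N s).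
Proof.
  intros HN Hs [|p]; [simpl; lra|]. unfold Lseq. apply Rmult_lt_0_compat.
  - apply pow_lt, lt_0_INR. lia.
  - apply MinRlist_P2. intros y Hy. apply in_map_iff in Hy.
    destruct Hy as [j [<- Hj]]. apply Rmult_lt_0_compat; [|apply (weight_pos N c HN)].
    apply pow_lt, Rdiv_lt_0_compat; [apply lt_0_INR; lia|apply (tail_pos N c HN)].
Qed.

Lemma descendant_equiv_Lseq (N : nat -> R) (c : R) (s : nat) :
  moderate N c -> (1 <= s)%nat -> equiv (descendant N) (Lseq N s).
Proof.
  intros HN Hs.
  assert (HS := descendant_pos N c HN). assert (HL := Lseq_pos N c s HN Hs).
  assert (Hs1 : 1 <= INR s) by (change 1 with (INR 1); apply le_INR; exact Hs).
  assert (Ht1 := tau_pos N c HN 1).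
  split; apply preceq_iff; auto.
  - exists (tau N 1). split; [exact Ht1|]. intros [|p] Hp; [lia|].
    unfold Lseq. set (q := S p) in *.
    assert (Htq : 0 < tau N 1 ^ q) by (apply pow_lt; exact Ht1).
    assert (Hsq : 1 <= INR s ^ q) by (apply pow_R1_Rle; exact Hs1).
    apply Rle_trans with (tau N 1 ^ q * (1 * (descendant N q / tau N 1 ^ q))).
    { right. field. lra. }
    apply Rmult_le_compat_l; [lra|]. apply Rmult_le_compat; try lra.
    { left. apply Rdiv_lt_0_compat; auto. }
    apply le_MinRlist; [unfold q; simpl; congruence|].
    intros y Hy. apply in_map_iff in Hy. destruct Hy as [j [<- Hj]].
    apply in_seq in Hj.
    apply Rmult_le_reg_l with (tau N 1 ^ q); [exact Htq|].
    replace (tau N 1 ^ q * (descendant N q / tau N 1 ^ q)) with (descendant N q)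
      by (field; lra).
    apply (descendant_le N c HN). lia.
  - destruct (tail_pow_le_descendant N c HN) as [d [Hd Hle]].
    exists (INR s * d). split; [apply Rmult_lt_0_compat; lra|].
    intros [|p] Hp; [lia|]. unfold Lseq. set (q := S p) in *.
    rewrite Rpow_mult_distr, Rmult_assoc.
    apply Rmult_le_compat_l; [apply pow_le; lra|].
    eapply Rle_trans; [|apply Hle; exact Hp].
    apply MinRlist_P1, in_map_iff. exists 0%nat. split.
    + rewrite (weight_0 N c HN), Nat.sub_0_r. ring.
    + apply in_seq. unfold q. lia.
Qed.

Lemma descendant_SV (N : nat -> R) (c : R) : moderate N c -> SV (descendant N) N.
Proof.
  intros HN. destruct (INR_unbounded (tau N 1)) as [s Hs].
  assert (Ht1 := tau_pos N c HN 1).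
  assert (Hs0 : (1 <= s)%nat).
  { destruct s; [simpl in Hs; lra|lia]. }
  exists s. split; [exact Hs0|]. exists 1. intros y [q ->]. set (p := S q).
  assert (Htp := tail_pos N c HN p).
  assert (Hp0 : 0 < INR p) by (apply lt_0_INR; unfold p; lia).
  assert (H : lambda (descendant N) N p s <= INR p / tail N p).
  { unfold lambda. set (l := map _ _).
    assert (Hin : In (MaxRlist l) l).
    { apply MaxRlist_P2. eexists. apply in_map, (in_seq p 0 0). unfold p; lia. }
    apply in_map_iff in Hin. destruct Hin as [j [<- Hj]]. apply in_seq in Hj.
    assert (HNj := weight_pos N c HN j).
    assert (Hsp : 0 < INR s ^ p) by (apply pow_lt; lra).
    assert (HSp := descendant_pos N c HN p).
    apply nth_root_le; [lia| | |].
    - apply Rdiv_lt_0_compat; [exact HSp|]. apply Rmult_lt_0_compat; assumption.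
    - apply Rdiv_le_0_compat; lra.
    - apply Rmult_le_reg_r with (INR s ^ p * N j).
      { apply Rmult_lt_0_compat; assumption. }
      replace (descendant N p / (INR s ^ p * N j) * (INR s ^ p * N j))
        with (descendant N p) by (field; lra).
      eapply Rle_trans; [apply (descendant_le N c HN p j); lia|].
      assert (Hpow : tau N 1 ^ p <= INR s ^ p) by (apply pow_incr; lra).
      rewrite (Rmult_comm _ (INR s ^ p * N j)), Rmult_assoc, (Rmult_comm (N j)).
      apply Rmult_le_compat_r; [|exact Hpow].
      apply Rmult_le_pos; [|lra]. apply pow_le, Rdiv_le_0_compat; lra. }
  apply Rmult_le_reg_r with (INR p / tail N p); [apply Rdiv_lt_0_compat; lra|].
  replace (lambda (descendant N) N p s / INR p * tail N p * (INR p / tail N p))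
    with (lambda (descendant N) N p s) by (field; lra). lra.
Qed.

Lemma SV_preceq_descendant (N M : nat -> R) (c : R) :
  moderate N c -> positive M -> SV M N -> preceq M (descendant N).
Proof.
  intros HN HM [s [Hs [y Hy]]].
  destruct (tail_pow_le_descendant N c HN) as [d [Hd Hle]].
  assert (Hs1 : 1 <= INR s) by (change 1 with (INR 1); apply le_INR; exact Hs).
  set (k := Rmax y 1).
  assert (Hk : 1 <= k) by apply Rmax_r.
  apply preceq_iff; [exact HM|apply (descendant_pos N c HN)|].
  exists (INR s * k * d). split.
  { repeat apply Rmult_lt_0_compat; lra. }
  intros p Hp. destruct p as [|q]; [lia|].
  assert (Hq : lambda M N (S q) s / INR (S q) * tail N (S q) <= k).
  { eapply Rle_trans; [apply Hy; exists q; reflexivity|apply Rmax_l]. }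
  set (p := S q) in *.
  assert (Htp := tail_pos N c HN p).
  assert (Hp0 : 0 < INR p) by (apply lt_0_INR; unfold p; lia).
  assert (Hl : lambda M N p s <= k * (INR p / tail N p)).
  { apply Rmult_le_reg_r with (/ INR p * tail N p).
    { apply Rmult_lt_0_compat; [apply Rinv_0_lt_compat|]; assumption. }
    apply Rle_trans with k; [unfold Rdiv in Hq; lra|]. right. field. lra. }
  assert (Hroot : nth_root p (M p / INR s ^ p) <= k * (INR p / tail N p)).
  { eapply Rle_trans; [|exact Hl]. apply MaxRlist_P1, in_map_iff.
    exists 0%nat. split.
    - rewrite (weight_0 N c HN), Nat.sub_0_r, Rmult_1_r. reflexivity.
    - apply in_seq. unfold p. lia. }
  assert (Hsp : 0 < INR s ^ p) by (apply pow_lt; lra).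
  apply nth_root_le in Hroot; [|exact Hp|apply Rdiv_lt_0_compat; auto|].
  2: { apply Rmult_le_pos; [lra|]. apply Rdiv_le_0_compat; lra. }
  specialize (Hle p Hp). rewrite Rpow_mult_distr in Hroot.
  assert (Hkp : 0 < k ^ p) by (apply pow_lt; lra).
  rewrite !Rpow_mult_distr.
  apply Rmult_le_reg_l with (/ INR s ^ p); [apply Rinv_0_lt_compat; exact Hsp|].
  apply Rle_trans with (k ^ p * (d ^ p * descendant N p)).
  - eapply Rle_trans; [|eapply Rle_trans; [exact Hroot|]].
    + right. unfold Rdiv. ring.
    + apply Rmult_le_compat_l; lra.
  - right. field. lra.
Qed.

(** * Jets and Bang's estimate for flat functions *)

(** A smooth function together with all its derivatives.  Working with the
    whole family avoids iterated derivatives in every construction below. *)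
Definition jet (u : nat -> R -> R) : Prop :=
  forall n x, is_derive (u n) x (u (S n) x).

Lemma jet_Derive_n (u : nat -> R -> R) :
  jet u -> forall n x, Derive_n (u 0%nat) n x = u n x.
Proof.
  intros Hu. induction n as [|n IH]; intros x; [reflexivity|].
  simpl. rewrite (Derive_ext _ (u n)) by exact IH.
  apply is_derive_unique, Hu.
Qed.

Lemma jet_ex_derive_n (u : nat -> R -> R) :
  jet u -> forall n x, ex_derive_n (u 0%nat) n x.
Proof.
  intros Hu [|n] x; [exact I|].
  apply ex_derive_ext with (u n).
  - intros t. symmetry. apply jet_Derive_n, Hu.
  - exists (u (S n) x). apply Hu.
Qed.

Lemma derive_nonneg_le (f df : R -> R) (a b : R) :
  a <= b -> (forall x, is_derive f x (df x)) ->
  (forall x, a <= x <= b -> 0 <= df x) -> f a <= f b.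
Proof.
  intros Hab Hf Hdf.
  destruct (MVT_gen f a b df) as [x [Hx Heq]].
  - intros x _. apply Hf.
  - intros x _. apply derivable_continuous_pt. exists (df x).
    apply is_derive_Reals, Hf.
  - rewrite Rmin_left, Rmax_right in Hx by exact Hab.
    specialize (Hdf x Hx). nra.
Qed.

Lemma derive_le_exp (f df : R -> R) (y h b k : R) :
  0 <= k -> (forall x, is_derive f x (df x)) -> Rabs (f y) <= b ->
  (forall t, 0 <= t <= h -> Rabs (df (y + t)) <= b * k * exp (k * t)) ->
  forall t, 0 <= t <= h -> Rabs (f (y + t)) <= b * exp (k * t).
Proof.
  intros Hk Hf Hy Hdf t Ht.
  assert (Hexp : forall x, is_derive (fun x => b * exp (k * (x - y))) x
                             (b * k * exp (k * (x - y)))).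
  { intros x. auto_derive; [exact I|]. unfold Rminus. ring. }
  assert (Hb : forall x, y <= x <= y + t ->
                 Rabs (df x) <= b * k * exp (k * (x - y))).
  { intros x Hx. replace x with (y + (x - y)) at 1 by ring. apply Hdf. lra. }
  assert (H1 := derive_nonneg_le
    (fun x => b * exp (k * (x - y)) - f x)
    (fun x => b * k * exp (k * (x - y)) - df x) y (y + t) ltac:(lra)).
  assert (H2 := derive_nonneg_le
    (fun x => b * exp (k * (x - y)) + f x)
    (fun x => b * k * exp (k * (x - y)) + df x) y (y + t) ltac:(lra)).
  simpl in H1, H2.
  replace (k * (y - y)) with 0 in H1, H2 by ring. rewrite exp_0 in H1, H2.
  replace (y + t - y) with t in H1, H2 by ring.
  apply Rabs_le_between in Hy.
  apply Rabs_le. split.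
  - assert (b * 1 + f y <= b * exp (k * t) + f (y + t)); [|lra].
    apply H2.
    + intros x. apply (is_derive_plus (V := R_NormedModule)); [apply Hexp|apply Hf].
    + intros x Hx. pose proof (Hb x Hx) as Hd. apply Rabs_le_between in Hd. lra.
  - assert (b * 1 - f y <= b * exp (k * t) - f (y + t)); [|lra].
    apply H1.
    + intros x. apply (is_derive_minus (V := R_NormedModule)); [apply Hexp|apply Hf].
    + intros x Hx. pose proof (Hb x Hx) as Hd. apply Rabs_le_between in Hd. lra.
Qed.

(** Bang's estimate.  The bound [exp (n - m) * W n] for the derivatives of
    order [n <= m] survives, with [m] lowered by one, a step of length
    [1 / (e * om m)], because Taylor's expansion over such a step costs at most
    a factor [e].  Starting from [J] vanishing derivatives, the point [x] can
    therefore move as far as the sum of these step lengths, which is written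
    as the difference of the tails [T]. *)
Lemma bang_flat (u : nat -> R -> R) (W om T : nat -> R) (J : nat) :
  jet u -> positive W -> positive om ->
  (forall n, W (S n) = om n * W n) ->
  (forall n m, (n <= m)%nat -> om n <= om m) ->
  (forall n, T n - T (S n) = / om n) ->
  (forall n x, Rabs (u n x) <= W n) ->
  (forall n, (n < J)%nat -> u n 0 = 0) ->
  forall m, (m <= J)%nat -> forall x, 0 <= x -> exp 1 * x <= T m - T J ->
  forall n, (n <= m)%nat -> Rabs (u n x) <= exp (INR n - INR m) * W n.
Proof.
  intros Hu HW Hom HWS Hmono HT Hbd Hflat m Hm.
  assert (He : 0 < exp 1) by apply exp_pos.
  replace m with (J - (J - m))%nat by lia.
  generalize (Nat.le_sub_l J m). set (k := (J - m)%nat). clearbody k. clear m Hm.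
  induction k as [|k IH]; intros Hk x Hx0 Hx n Hn.
  - rewrite Nat.sub_0_r in *.
    assert (Hx00 : x = 0) by nra. subst x.
    destruct (Nat.eq_dec n J) as [->|Hne].
    + rewrite Rminus_diag, exp_0. pose proof (Hbd J 0). lra.
    + rewrite Hflat by lia. rewrite Rabs_R0.
      apply Rmult_le_pos; left; [apply exp_pos|apply HW].
  - set (m := (J - S k)%nat) in *.
    assert (Hm1 : (J - k)%nat = S m) by (unfold m; lia).
    rewrite Hm1 in IH. specialize (IH ltac:(lia)).
    set (y := (T (S m) - T J) / exp 1).
    assert (HTdec : forall i, (S m + i <= J)%nat -> T (S m + i)%nat <= T (S m)).
    { induction i as [|i IHi]; intros Hi; [rewrite Nat.add_0_r; lra|].
      rewrite Nat.add_succ_r. specialize (IHi ltac:(lia)).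
      pose proof (HT (S m + i)%nat).
      pose proof (Rinv_0_lt_compat _ (Hom (S m + i)%nat)). lra. }
    assert (Hy0 : 0 <= y).
    { apply Rdiv_le_0_compat; [|exact He].
      specialize (HTdec (J - S m)%nat ltac:(lia)).
      replace (S m + (J - S m))%nat with J in HTdec by lia. lra. }
    assert (Hey : exp 1 * y = T (S m) - T J) by (unfold y; field; lra).
    destruct (Rle_lt_dec x y) as [Hxy|Hxy].
    { eapply Rle_trans; [apply IH; [exact Hx0|nra|lia]|].
      apply Rmult_le_compat_r; [left; apply HW|].
      rewrite S_INR. left. apply exp_increasing. lra. }
    assert (Hstep : forall i, (i <= S m)%nat -> forall t, 0 <= t <= / om m / exp 1 ->
      Rabs (u (S m - i)%nat (y + t)) <=
      exp (INR (S m - i) - INR (S m)) * W (S m - i)%nat * exp (exp 1 * om m * t)).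
    { induction i as [|i IHi]; intros Hi.
      - intros t Ht. rewrite Nat.sub_0_r, Rminus_diag, exp_0, Rmult_1_l.
        eapply Rle_trans; [apply Hbd|].
        rewrite <- (Rmult_1_r (W (S m))) at 1.
        apply Rmult_le_compat_l; [left; apply HW|].
        pose proof (exp_ineq1_le (exp 1 * om m * t)).
        assert (0 <= exp 1 * om m * t).
        { repeat apply Rmult_le_pos; try lra. left; apply Hom. }
        lra.
      - specialize (IHi ltac:(lia)).
        set (l := (S m - S i)%nat) in *.
        assert (Hl : (S m - i)%nat = S l) by (unfold l; lia).
        rewrite Hl in IHi.
        apply derive_le_exp with (df := u (S l)).
        + apply Rmult_le_pos; [lra|]. left; apply Hom.
        + intros z. apply Hu.
        + apply IH; [exact Hy0|lra|unfold l; lia].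
        + intros t Ht. eapply Rle_trans; [apply IHi; exact Ht|].
          apply Rmult_le_compat_r; [left; apply exp_pos|].
          rewrite (S_INR l), HWS.
          replace (INR l + 1 - INR (S m)) with (INR l - INR (S m) + 1) by ring.
          rewrite exp_plus.
          assert (Hol : om l <= om m) by (apply Hmono; unfold l; lia).
          assert (0 < exp (INR l - INR (S m))) by apply exp_pos.
          pose proof (HW l).
          replace (exp (INR l - INR (S m)) * exp 1 * (om l * W l)) with
            (exp (INR l - INR (S m)) * W l * exp 1 * om l) by ring.
          replace (exp (INR l - INR (S m)) * W l * (exp 1 * om m)) with
            (exp (INR l - INR (S m)) * W l * exp 1 * om m) by ring.
          apply Rmult_le_compat_l; [|exact Hol].
          repeat apply Rmult_le_pos; lra. }
    specialize (Hstep (S m - n)%nat ltac:(lia) (x - y)).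
    replace (S m - (S m - n))%nat with n in Hstep by lia.
    replace (y + (x - y)) with x in Hstep by ring.
    pose proof (HT m) as HTm. pose proof (Hom m) as Homm.
    assert (Hh : x - y <= / om m / exp 1).
    { apply Rmult_le_reg_l with (exp 1); [exact He|].
      replace (exp 1 * (/ om m / exp 1)) with (/ om m) by (field; lra). lra. }
    eapply Rle_trans; [apply Hstep; lra|].
    assert (Hexp : exp (exp 1 * om m * (x - y)) <= exp 1).
    { assert (Hle : exp 1 * om m * (x - y) <= 1).
      { apply Rle_trans with (exp 1 * om m * (/ om m / exp 1)).
        - apply Rmult_le_compat_l; [|exact Hh]. apply Rmult_le_pos; lra.
        - right. field. lra. }
      destruct Hle as [Hlt|Heq]; [left; apply exp_increasing; exact Hlt|].
      rewrite Heq. lra. }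
    replace (INR n - INR m) with (INR n - INR (S m) + 1) by (rewrite S_INR; ring).
    rewrite exp_plus. pose proof (exp_pos (INR n - INR (S m))). pose proof (HW n).
    apply Rle_trans with (exp (INR n - INR (S m)) * W n * exp 1); [|right; ring].
    apply Rmult_le_compat_l; [|exact Hexp]. apply Rmult_le_pos; lra.
Qed.

(** * Growth of Taylor coefficients in the presence of gaps *)

Lemma fact_le_pow (p i : nat) : (i <= p)%nat -> INR (fact i) <= INR p ^ i.
Proof.
  induction i as [|i IH]; intros Hi; [simpl; lra|].
  rewrite fact_simpl, mult_INR. simpl pow. apply Rmult_le_compat.
  - apply pos_INR.
  - apply pos_INR.
  - apply le_INR; exact Hi.
  - apply IH; lia.
Qed.

Lemma pow_le_exp (y : R) (p : nat) :
  0 <= y -> (1 <= p)%nat -> y ^ p <= INR p ^ p * exp y.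
Proof.
  intros Hy Hp. assert (Hp0 : 0 < INR p) by (apply lt_0_INR; lia).
  assert (H : (y / INR p) ^ p <= exp y).
  { eapply Rle_trans; [|apply (pow_one_plus_div_le y p Hy Hp)].
    apply pow_incr. assert (0 <= y / INR p) by (apply Rdiv_le_0_compat; lra). lra. }
  replace y with (INR p * (y / INR p)) at 1 by (field; lra).
  rewrite Rpow_mult_distr. apply Rmult_le_compat_l; [apply pow_le; lra|exact H].
Qed.

(** A lower bound on the [p]-th derivative is integrated [i] times; the
    nonnegative initial values can only help. *)
Lemma taylor_lower_bound (u : nat -> R -> R) (p : nat) (b X : R) :
  jet u -> (forall i, (i < p)%nat -> 0 <= u i 0) ->
  (forall x, 0 <= x <= X -> b <= u p x) ->
  forall i, (i <= p)%nat -> forall x, 0 <= x <= X ->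
  b * (x ^ i / INR (fact i)) <= u (p - i)%nat x.
Proof.
  intros Hu H0 Hp. induction i as [|i IH]; intros Hi x Hx.
  - rewrite Nat.sub_0_r. simpl. specialize (Hp x Hx). lra.
  - set (l := (p - S i)%nat) in *.
    assert (Hl : (p - i)%nat = S l) by (unfold l; lia). rewrite Hl in IH.
    specialize (IH ltac:(lia)).
    assert (Hf := INR_fact_lt_0 i). assert (HSi : 0 < INR (S i)) by (apply lt_0_INR; lia).
    assert (Hd := derive_nonneg_le
      (fun x => u l x - b * (x ^ S i / INR (fact (S i))))
      (fun x => u (S l) x - b * (x ^ i / INR (fact i))) 0 x ltac:(lra)).
    assert (H : u l 0 - b * (0 ^ S i / INR (fact (S i))) <=
                u l x - b * (x ^ S i / INR (fact (S i)))).
    { apply Hd.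
      - intros z. apply (is_derive_minus (V := R_NormedModule)); [apply Hu|].
        auto_derive; [exact I|].
        change (fact i + i * fact i)%nat with (S i * fact i)%nat.
        change (match i with O => 1 | S _ => INR i + 1 end) with (INR (S i)).
        rewrite mult_INR.
        field. lra.
      - intros z Hz. specialize (IH z ltac:(lra)). lra. }
    specialize (H0 l ltac:(unfold l; lia)).
    rewrite pow_i in H by lia. unfold Rdiv at 1 in H. lra.
Qed.

Lemma weight_le_nu_pow (N : nat -> R) (c : R) : moderate N c ->
  forall p, N p <= nu N p ^ p.
Proof.
  intros HN p.
  assert (H : forall i, (i <= p)%nat -> N i <= nu N p ^ i).
  { induction i as [|i IH]; intros Hi; [rewrite (weight_0 N c HN); simpl; lra|].
    rewrite (weight_S N i (weight_pos N c HN)). simpl pow. rewrite Rmult_comm.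
    apply Rmult_le_compat; [left; apply nu_pos, (weight_pos N c HN)|
      left; apply (weight_pos N c HN)|apply (nu_mono N c HN); exact Hi|apply IH; lia]. }
  apply H. lia.
Qed.

(** The gap of length [J] makes [f^(p) - f^(p)(0)] flat, so by Bang's estimate
    [f^(p)] stays above [f^(p)(0) / 2] on an interval whose length [X] is
    comparable to [t_p], unless [f^(p)(0)] is already small.  Integrating [p]
    times, with nonnegative initial values, gives
    [f^(p)(0) / 2 * X^p / p! <= f(X) <= b]. *)
Lemma coefficient_bound (N : nat -> R) (c b k : R) :
  moderate N c -> 1 <= b -> 0 < k ->
  exists d, 0 < d /\ forall u, jet u ->
  (forall n x, Rabs (u n x) <= b * (k ^ n * N n)) ->
  forall p J, (1 <= p)%nat -> tail N (p + J + 1) <= tail N (2 * p) / 4 ->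
  (forall i, (i <= p)%nat -> 0 <= u i 0) ->
  (forall n, (1 <= n < J)%nat -> u (p + n)%nat 0 = 0) ->
  u p 0 <= d ^ p * (INR p / tail N p) ^ p.
Proof.
  intros HN Hb Hk.
  assert (HNp := weight_pos N c HN). assert (Hc := const_pos N c HN).
  assert (He1 := exp_ineq1_le 1).
  set (d0 := 4 * b * exp 1). set (d1 := 4 * exp 1 * k * (1 + c)).
  assert (Hd0 : 1 <= d0) by (unfold d0; nra).
  assert (Hd1 : 0 < d1).
  { unfold d1. repeat apply Rmult_lt_0_compat; lra. }
  exists (d0 * d1). split; [apply Rmult_lt_0_compat; lra|].
  intros u Hu Hbd p J Hp HJ Hpos Hflat.
  assert (Hp0 : 0 < INR p) by (apply lt_0_INR; lia).
  set (a := u p 0). set (t := tail N p). set (t2 := tail N (2 * p)) in *.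
  assert (Ht : 0 < t) by apply (tail_pos N c HN).
  assert (Ht2 : 0 < t2) by apply (tail_pos N c HN).
  assert (Htt : t <= (1 + c) * t2) by apply (tail_double N c HN).
  assert (Hinv : / t2 <= (1 + c) / t).
  { apply Rmult_le_reg_r with (t * t2); [nra|]. field_simplify; lra. }
  (* [exp (- m)] has to absorb [(nu_p * t_p / p)^p], while the [m] steps spent
     on it must use up at most half of [t2] *)
  set (y := nu N p * t2 / 2).
  assert (Hnu := nu_pos N HNp p).
  assert (Hy : 0 <= y) by (unfold y; apply Rdiv_le_0_compat; nra).
  destruct (nfloor_ex y Hy) as [m [Hm1 Hm2]].
  assert (Htm : t2 / 2 <= tail N (p + m + 1)).
  { pose proof (tail_le_block N c HN (2 * p) m) as H. fold t2 in H.
    pose proof (tail_mono N c HN (p + m + 1) (2 * p + m) ltac:(lia)) as H1.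
    assert (H2 : / nu N (2 * p) <= / nu N p).
    { apply Rinv_le_contravar; [exact Hnu|]. apply (nu_mono N c HN). lia. }
    assert (H3 : INR m * / nu N p <= t2 / 2).
    { apply Rle_trans with (y * / nu N p).
      - apply Rmult_le_compat_r; [left; apply Rinv_0_lt_compat, Hnu|exact Hm1].
      - right. unfold y. field. lra. }
    assert (INR m * / nu N (2 * p) <= INR m * / nu N p).
    { apply Rmult_le_compat_l; [apply pos_INR|exact H2]. }
    lra. }
  assert (HmJ : (m <= J)%nat).
  { destruct (le_lt_dec m J) as [H|H]; [exact H|exfalso].
    pose proof (tail_mono N c HN (p + J + 1) (p + m + 1) ltac:(lia)). lra. }
  set (X := t2 / (4 * exp 1 * k)).
  assert (HX : 0 < X).
  { unfold X. apply Rdiv_lt_0_compat; [exact Ht2|]. repeat apply Rmult_lt_0_compat; lra. }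
  assert (HC : exp 1 * X = t2 / 4 / k) by (unfold X; field; lra).
  set (v := fun n x => match n with O => u p x - a | S _ => u (p + n)%nat x end).
  assert (Hkn : forall n, 0 < k ^ n) by (intros n; apply pow_lt; exact Hk).
  assert (Hv : forall x, 0 <= x <= X ->
    Rabs (u p x - a) <= exp (- INR m) * (2 * b * (k ^ p * N p))).
  { intros x Hx.
    assert (H := bang_flat v (fun n => 2 * b * (k ^ (p + n) * N (p + n)%nat))
       (fun n => k * nu N (p + n + 1)) (fun n => tail N (p + n + 1) / k) J).
    simpl in H.
    assert (H' := fun A1 A2 A3 A4 A5 A6 A7 A8 A9 A10 =>
      H A1 A2 A3 A4 A5 A6 A7 A8 m HmJ x (proj1 Hx) A9 0%nat A10).
    rewrite !Nat.add_0_r in H'. replace (INR 0 - INR m) with (- INR m) in H' by (simpl; ring).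
    apply H'; clear H H'.
    - intros [|n] z.
      + apply is_derive_ext with (fun z => minus (u p z) a); [reflexivity|].
        replace (v 1%nat z) with (minus (u (S p) z) 0).
        * apply (is_derive_minus (V := R_NormedModule)); [apply Hu|].
          apply (is_derive_const (V := R_NormedModule)).
        * unfold v, minus, plus, opp. simpl. rewrite Nat.add_1_r. ring.
      + unfold v. rewrite (Nat.add_succ_r p (S n)). apply Hu.
    - intros n. specialize (Hkn (p + n)%nat). specialize (HNp (p + n)%nat).
      repeat apply Rmult_lt_0_compat; lra.
    - intros n. apply Rmult_lt_0_compat; [exact Hk|apply nu_pos; exact HNp].
    - intros n. rewrite Nat.add_succ_r, (weight_S N (p + n) HNp), Nat.add_1_r.
      simpl pow. ring.
    - intros i j Hij. apply Rmult_le_compat_l; [lra|]. apply (nu_mono N c HN). lia.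
    - intros n. replace (p + S n + 1)%nat with (S (p + n + 1)) by lia.
      rewrite (tail_S N c HN (p + n + 1)).
      pose proof (nu_pos N HNp (p + n + 1)). field. lra.
    - intros [|n] z; unfold v.
      + rewrite Nat.add_0_r. pose proof (Hbd p z) as H1. pose proof (Hbd p 0) as H2.
        fold a in H2. unfold Rminus. eapply Rle_trans; [apply Rabs_triang|].
        rewrite Rabs_Ropp. lra.
      + pose proof (Hbd (p + S n)%nat z). specialize (HNp (p + S n)%nat).
        specialize (Hkn (p + S n)%nat).
        assert (0 < b * (k ^ (p + S n) * N (p + S n)%nat)).
        { repeat apply Rmult_lt_0_compat; lra. }
        lra.
    - intros [|n] Hn; unfold v; [unfold a; ring|]. apply Hflat. lia.
    - apply Rle_trans with (exp 1 * X); [apply Rmult_le_compat_l; lra|].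
      rewrite HC. unfold Rdiv. rewrite <- Rmult_minus_distr_r.
      apply Rmult_le_compat_r; [left; apply Rinv_0_lt_compat, Hk|]. lra.
    - lia. }
  assert (Hd0p : d0 <= d0 ^ p).
  { rewrite <- (pow_1 d0) at 1. apply Rle_pow; [exact Hd0|exact Hp]. }
  assert (Hd1p : 0 < d1 ^ p) by (apply pow_lt; exact Hd1).
  assert (Htp : 0 < (INR p / t) ^ p).
  { apply pow_lt, Rdiv_lt_0_compat; assumption. }
  apply Rle_trans with (d0 * (d1 ^ p * (INR p / t) ^ p)).
  2: { rewrite Rpow_mult_distr, Rmult_assoc. apply Rmult_le_compat_r; [nra|exact Hd0p]. }
  set (e0 := exp (- INR m) * (2 * b * (k ^ p * N p))) in *.
  destruct (Rle_lt_dec a (2 * e0)) as [Ha|Ha].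
    eapply Rle_trans; [exact Ha|]. unfold e0.
    assert (Hem : exp (- INR m) <= exp 1 * exp (- y)).
    { rewrite <- exp_plus. left. apply exp_increasing. lra. }
    assert (HNk : k ^ p * N p <= (k * nu N p) ^ p).
    { rewrite Rpow_mult_distr. apply Rmult_le_compat_l; [left; apply Hkn|].
      apply (weight_le_nu_pow N c HN). }
    assert (Hnut : k * nu N p <= 2 * k * (1 + c) / t * y).
    { apply Rle_trans with (2 * k * y * / t2).
      - right. unfold y. field. lra.
      - apply Rle_trans with (2 * k * y * ((1 + c) / t)).
        + apply Rmult_le_compat_l; [|exact Hinv]. nra.
        + right. field. lra. }
    assert (Hpow : (k * nu N p) ^ p <= (2 * k * (1 + c) / t) ^ p * (INR p ^ p * exp y)).
    { eapply Rle_trans; [apply pow_incr; split; [|exact Hnut]; nra|].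
      rewrite Rpow_mult_distr. apply Rmult_le_compat_l.
      - apply pow_le, Rdiv_le_0_compat; [nra|exact Ht].
      - apply pow_le_exp; assumption. }
    assert (Hfin : (2 * k * (1 + c) / t) ^ p * INR p ^ p <= d1 ^ p * (INR p / t) ^ p).
    { rewrite <- !Rpow_mult_distr. apply pow_incr.
      assert (0 <= k * (1 + c) * INR p / t).
      { apply Rdiv_le_0_compat; [|exact Ht]. repeat apply Rmult_le_pos; lra. }
      split.
      - apply Rle_trans with (2 * (k * (1 + c) * INR p / t)); [lra|]. right. field. lra.
      - apply Rle_trans with (2 * (k * (1 + c) * INR p / t)); [right; field; lra|].
        apply Rle_trans with (4 * exp 1 * (k * (1 + c) * INR p / t)).
        + apply Rmult_le_compat_r; lra.
        + right. unfold d1. field. lra. }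
    apply Rle_trans with (2 * (exp 1 * exp (- y) * (2 * b *
      ((2 * k * (1 + c) / t) ^ p * (INR p ^ p * exp y))))).
    + apply Rmult_le_compat_l; [lra|].
      apply Rmult_le_compat; [left; apply exp_pos| |exact Hem|].
      * specialize (HNp p). specialize (Hkn p). repeat apply Rmult_le_pos; lra.
      * apply Rmult_le_compat_l; lra.
    + apply Rle_trans with (d0 * ((2 * k * (1 + c) / t) ^ p * INR p ^ p)).
      * right. unfold d0.
        replace (exp y) with (/ exp (- y)) by (rewrite exp_Ropp, Rinv_inv; reflexivity).
        pose proof (exp_pos (- y)). field. lra.
      * apply Rmult_le_compat_l; [lra|exact Hfin].
  - assert (Hlow : forall x, 0 <= x <= X -> a / 2 <= u p x).
    { intros x Hx. specialize (Hv x Hx). apply Rabs_le_between in Hv. lra. }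
    pose proof (taylor_lower_bound u p (a / 2) X Hu
      (fun i Hi => Hpos i (Nat.lt_le_incl _ _ Hi)) Hlow p (Nat.le_refl p) X
      ltac:(lra)) as H.
    rewrite Nat.sub_diag in H. pose proof (Hbd 0%nat X) as Hb0.
    rewrite (weight_0 N c HN) in Hb0. simpl in Hb0. apply Rabs_le_between in Hb0.
    assert (Hf := INR_fact_lt_0 p). assert (HXp : 0 < X ^ p) by (apply pow_lt; exact HX).
    assert (Ha0 : a <= 2 * b * (INR (fact p) * / X ^ p)).
    { apply Rmult_le_reg_r with (X ^ p / INR (fact p)).
      { apply Rdiv_lt_0_compat; assumption. }
      apply Rle_trans with (2 * b); [lra|]. right. field. lra. }
    eapply Rle_trans; [exact Ha0|].
    assert (HXinv : (/ X) ^ p * INR p ^ p <= d1 ^ p * (INR p / t) ^ p).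
    { rewrite <- !Rpow_mult_distr. apply pow_incr.
      assert (HiX : / X = 4 * exp 1 * k * / t2) by (unfold X; field; lra).
      assert (0 < / X) by (apply Rinv_0_lt_compat; exact HX).
      split; [nra|]. rewrite HiX.
      apply Rle_trans with (4 * exp 1 * k * ((1 + c) / t) * INR p).
      - apply Rmult_le_compat_r; [lra|]. apply Rmult_le_compat_l; [nra|exact Hinv].
      - right. unfold d1. field. lra. }
    apply Rmult_le_compat; [lra| |unfold d0; nra|].
    + apply Rmult_le_pos; [lra|]. left. apply Rinv_0_lt_compat; exact HXp.
    + eapply Rle_trans; [|exact HXinv]. rewrite Rmult_comm, pow_inv.
      apply Rmult_le_compat_l; [left; apply Rinv_0_lt_compat; exact HXp|].
      apply fact_le_pow. lia.
Qed.

(** * A test sequence for the Borel map *)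

Lemma dependent_choice (P : nat -> nat -> nat -> Prop) :
  (forall i p, exists q, P i p q) ->
  exists g : nat -> nat, forall i, P i (g i) (g (S i)).
Proof.
  intros H.
  exists (nat_rect (fun _ => nat) 0%nat
    (fun i p => proj1_sig (constructive_indefinite_description _ (H i p)))).
  intros i. simpl.
  apply (proj2_sig (constructive_indefinite_description _ (H i _))).
Qed.

(** Finitely many indices can be absorbed into the constant of [preceq], so its
    failure is visible at arbitrarily large indices. *)
Lemma not_preceq_large (M K : nat -> R) :
  positive M -> positive K -> ~ preceq M K ->
  forall y P, exists p, (P <= p)%nat /\ y ^ p * K p < M p.
Proof.
  intros HM HK Hnot y P.
  apply NNPP. intros Hno. apply Hnot. apply preceq_iff; auto.
  destruct (ex_finite_bound (fun p => M p / K p) P) as [d [Hd Hfin]].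
  set (k := Rmax (Rabs y) (Rmax d 1)).
  assert (Hk1 : 1 <= k) by (unfold k; eapply Rle_trans; apply Rmax_r).
  assert (Hkd : d <= k).
  { unfold k. eapply Rle_trans; [apply Rmax_l|apply Rmax_r]. }
  assert (Hky : Rabs y <= k) by apply Rmax_l.
  exists k. split; [lra|]. intros p Hp. assert (HKp := HK p).
  destruct (le_lt_dec p P) as [HpP|HpP].
  - specialize (Hfin p HpP). simpl in Hfin.
    apply Rle_trans with (d * K p).
    + apply Rmult_le_reg_r with (/ K p); [apply Rinv_0_lt_compat, HK|].
      rewrite (Rmult_assoc d), Rinv_r, Rmult_1_r by lra. exact Hfin.
    + apply Rmult_le_compat_r; [lra|]. apply Rle_trans with k; [exact Hkd|].
      rewrite <- (pow_1 k) at 1. apply Rle_pow; assumption.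
  - apply Rnot_lt_le. intros Hlt. apply Hno. exists p. split; [lia|].
    eapply Rle_lt_trans; [|exact Hlt]. apply Rmult_le_compat_r; [lra|].
    eapply Rle_trans; [apply Rle_abs|]. rewrite <- RPow_abs.
    apply pow_incr. split; [apply Rabs_pos|exact Hky].
Qed.

(** A single lacunary sequence replaces a uniform boundedness argument for the
    Borel map: it is so much smaller than [M] that it lies in the smallest of
    the sequence spaces, and yet no geometric sequence times the descendant
    bounds it.  The gaps are long enough for the tails to drop by a fixed
    factor, as Bang's estimate requires. *)
Lemma test_sequence (N M : nat -> R) (c : R) :
  moderate N c -> positive M -> ~ preceq M (descendant N) ->
  exists (g : nat -> nat) (a : nat -> R),
    (forall i, (1 <= g i < g (S i))%nat /\
               tail N (g (S i)) <= tail N (2 * g i) / 4) /\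
    (forall i, a (g i) = INR (S i) ^ g i * descendant N (g i)) /\
    (forall q, (forall i, g i <> q) -> a q = 0) /\
    Lambda_B M (fun q => RtoC (a q)).
Proof.
  intros HN HM Hnot. set (S0 := descendant N) in *.
  assert (HS : positive S0) by apply (descendant_pos N c HN).
  destruct (dependent_choice (fun i p q => (p < q)%nat /\
    tail N q <= tail N (2 * p) / 4 /\ (INR (S i) ^ 2) ^ q * S0 q < M q))
    as [g0 Hg0].
  { intros i p.
    pose proof (tail_lim N c HN) as Hlim. apply is_lim_seq_spec in Hlim.
    assert (He : 0 < tail N (2 * p) / 4).
    { pose proof (tail_pos N c HN (2 * p)). lra. }
    destruct (Hlim (mkposreal _ He)) as [P HP]. cbn [pos] in HP.
    destruct (not_preceq_large M S0 HM HS Hnot (INR (S i) ^ 2) (P + S p))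
      as [q [Hq1 Hq2]].
    exists q. split; [lia|]. split; [|exact Hq2].
    specialize (HP q ltac:(lia)). rewrite Rminus_0_r in HP.
    rewrite Rabs_pos_eq in HP by (left; apply (tail_pos N c HN)). lra. }
  set (g := fun i => g0 (S i)).
  assert (Hmono : forall i k, (g i < g (S i + k))%nat).
  { intros i. induction k as [|k IH].
    - rewrite Nat.add_0_r. apply (Hg0 (S i)).
    - rewrite Nat.add_succ_r. eapply Nat.lt_trans; [exact IH|].
      apply (Hg0 (S (S i + k))). }
  assert (Hinj : forall i j, g i = g j -> i = j).
  { intros i j Hij. destruct (lt_eq_lt_dec i j) as [[H|H]|H]; auto; exfalso.
    - specialize (Hmono i (j - S i)%nat).
      replace (S i + (j - S i))%nat with j in Hmono by lia. lia.
    - specialize (Hmono j (i - S j)%nat).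
      replace (S j + (i - S j))%nat with i in Hmono by lia. lia. }
  assert (Hval : forall q, exists v,
    (forall i, g i = q -> v = INR (S i) ^ g i * S0 (g i)) /\
    ((forall i, g i <> q) -> v = 0)).
  { intros q. destruct (classic (exists i, g i = q)) as [[i Hi]|Hno].
    - exists (INR (S i) ^ g i * S0 (g i)). split.
      + intros j Hj. replace j with i; [reflexivity|]. apply Hinj. congruence.
      + intros H. destruct (H i Hi).
    - exists 0. split; [|reflexivity]. intros i Hi. destruct Hno. exists i; exact Hi. }
  set (a := fun q => proj1_sig (constructive_indefinite_description _ (Hval q))).
  assert (Ha : forall q, (forall i, g i = q -> a q = INR (S i) ^ g i * S0 (g i)) /\
                         ((forall i, g i <> q) -> a q = 0)).
  { intros q. apply (proj2_sig (constructive_indefinite_description _ (Hval q))). }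
  exists g, a. split; [|split; [|split]].
  - intros i. destruct (Hg0 (S i)) as [H1 [H2 _]].
    destruct (Hg0 i) as [H3 _]. split; [|exact H2]. split; [unfold g; lia|exact H1].
  - intros i. apply Ha. reflexivity.
  - intros q. apply Ha.
  - intros h Hh.
    destruct (INR_unbounded (/ h)) as [I HI].
    destruct (ex_finite_bound (fun i => / (h * INR (S i)) ^ g i) I) as [d [Hd Hfin]].
    exists (Rmax d 1). intros y [q ->]. rewrite Cmod_R.
    assert (Hhq : 0 < h ^ q) by (apply pow_lt; exact Hh).
    assert (HMq := HM q).
    destruct (classic (exists i, g i = q)) as [[i Hi]|Hno].
    + rewrite (proj1 (Ha q) i Hi). rewrite Hi.
      assert (Hi0 : 0 < INR (S i)) by (apply lt_0_INR; lia).
      assert (Hiq : 0 < INR (S i) ^ q) by (apply pow_lt; exact Hi0).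
      assert (HSq := HS q).
      rewrite Rabs_pos_eq by (apply Rmult_le_pos; lra).
      assert (Hle : INR (S i) ^ q * S0 q / (h ^ q * M q) <= / (h * INR (S i)) ^ q).
      { destruct (Hg0 i) as [_ [_ H3]]. fold (g i) in H3. rewrite Hi in H3.
        rewrite <- Rsqr_pow2 in H3. unfold Rsqr in H3.
        rewrite Rpow_mult_distr in *.
        apply Rmult_le_reg_r with (h ^ q * M q * INR (S i) ^ q).
        { repeat apply Rmult_lt_0_compat; assumption. }
        apply Rle_trans with (INR (S i) ^ q * INR (S i) ^ q * S0 q);
          [right; field; lra|].
        apply Rle_trans with (M q); [lra|]. right. field. lra. }
      eapply Rle_trans; [exact Hle|].
      destruct (le_lt_dec i I) as [HiI|HiI].
      * specialize (Hfin i HiI). cbn beta in Hfin. rewrite Hi in Hfin.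
        eapply Rle_trans; [exact Hfin|apply Rmax_l].
      * eapply Rle_trans; [|apply Rmax_r]. rewrite <- Rinv_1.
        apply Rinv_le_contravar; [lra|]. apply pow_R1_Rle.
        apply Rle_trans with (h * / h); [right; field; lra|].
        apply Rmult_le_compat_l; [lra|]. left. eapply Rlt_trans; [exact HI|].
        apply lt_INR. lia.
    + rewrite (proj2 (Ha q)).
      * rewrite Rabs_R0. unfold Rdiv. rewrite Rmult_0_l.
        eapply Rle_trans; [|apply Rmax_l]. lra.
      * intros i Hi. apply Hno. exists i; exact Hi.
Qed.

Lemma Lambda_B_R (M : nat -> R) (a : nat -> C) : Lambda_B M a -> Lambda_R M a.
Proof. intros H. exists 1. split; [lra|]. apply H. lra. Qed.

(** A function whose Borel image is the test sequence contradicts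
    [coefficient_bound] at [p = g i] for large [i].  Stated with
    a fixed [h] for each function, this serves both types of spaces. *)
Lemma test_sequence_optimal (N M : nat -> R) (c : R) :
  moderate N c -> positive M ->
  (forall a, Lambda_B M a ->
     exists h f, 0 < h /\ D N h f /\ forall p, Borel f p = a p) ->
  preceq M (descendant N).
Proof.
  intros HN HM Hcov. apply NNPP. intros Hnot.
  destruct (test_sequence N M c HN HM Hnot) as [g [a [Hg [Hag [Ha0 HaB]]]]].
  destruct (Hcov _ HaB) as [h [f [Hh [[Hsm [_ [b Hb]]] Hf]]]].
  set (u := fun n x => Derive_n (fun t => Re (f t)) n x).
  assert (Hu : jet u).
  { intros n x. apply Derive_correct. apply (proj1 (Hsm (S n) x)). }
  assert (Hu0 : forall n, u n 0 = a n).
  { intros n. specialize (Hf n). apply (f_equal Re) in Hf. exact Hf. }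
  set (b1 := Rmax b 1).
  assert (Hb1 : 1 <= b1) by apply Rmax_r.
  assert (Hubd : forall n x, Rabs (u n x) <= b1 * (h ^ n * N n)).
  { intros n x. assert (Hw : 0 < h ^ n * N n).
    { apply Rmult_lt_0_compat; [apply pow_lt; exact Hh|apply (weight_pos N c HN)]. }
    apply Rle_trans with (Cmod (CDerive_n f n x)).
    { eapply Rle_trans; [|apply Rmax_Cmod]. apply Rmax_l. }
    apply Rmult_le_reg_r with (/ (h ^ n * N n)); [apply Rinv_0_lt_compat; exact Hw|].
    rewrite (Rmult_assoc b1), Rinv_r, Rmult_1_r by lra.
    eapply Rle_trans; [|apply Rmax_l]. apply Hb. exists n, x. reflexivity. }
  destruct (coefficient_bound N c b1 h HN Hb1 Hh) as [d [Hd Hcoef]].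
  destruct (tail_pow_le_descendant N c HN) as [e [He Hdesc]].
  destruct (INR_unbounded (d * e)) as [i Hi].
  destruct (Hg i) as [[Hg1 Hg2] Hg3]. set (p := g i) in *.
  assert (Hmono : forall j k, (g j <= g (j + k))%nat).
  { intros j. induction k as [|k IH]; [rewrite Nat.add_0_r; lia|].
    rewrite Nat.add_succ_r. pose proof (proj2 (proj1 (Hg (j + k)%nat))). lia. }
  assert (Hap : u p 0 <= d ^ p * (INR p / tail N p) ^ p).
  { apply (Hcoef u Hu Hubd p (g (S i) - p)%nat Hg1).
    - eapply Rle_trans; [apply (tail_mono N c HN (g (S i))); lia|exact Hg3].
    - intros j _. rewrite Hu0.
      destruct (classic (exists l, g l = j)) as [[l <-]|Hno].
      + rewrite Hag. apply Rmult_le_pos; [apply pow_le, pos_INR|].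
        left. apply (descendant_pos N c HN).
      + rewrite Ha0; [lra|]. intros l Hl. apply Hno. exists l; exact Hl.
    - intros n Hn. rewrite Hu0. apply Ha0. intros l Hl.
      destruct (le_lt_dec l i) as [H|H].
      + pose proof (Hmono l (i - l)%nat) as Hm.
        replace (l + (i - l))%nat with i in Hm by lia. fold p in Hm. lia.
      + pose proof (Hmono (S i) (l - S i)%nat) as Hm.
        replace (S i + (l - S i))%nat with l in Hm by lia. lia. }
  assert (Hagp := Hag i). fold p in Hagp. rewrite Hu0, Hagp in Hap.
  specialize (Hdesc p Hg1).
  assert (HSp := descendant_pos N c HN p).
  assert (Hdp : 0 < d ^ p) by (apply pow_lt; exact Hd).
  assert (Hle : INR (S i) ^ p <= (d * e) ^ p).
  { rewrite Rpow_mult_distr. apply Rmult_le_reg_r with (descendant N p); [exact HSp|].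
    eapply Rle_trans; [exact Hap|]. rewrite Rmult_assoc.
    apply Rmult_le_compat_l; lra. }
  assert (Hlt : (d * e) ^ p < INR (S i) ^ p); [|lra].
  apply pow_lt_compat_l; [exact Hg1|]. split.
  - apply Rmult_le_pos; lra.
  - eapply Rlt_trans; [exact Hi|]. apply lt_INR. lia.
Qed.

(** * Smooth cutoff functions with prescribed derivative bounds *)

Definition average (w : R) (g : R -> R) (x : R) : R :=
  RInt (fun t => g (x + t)) (- w) w / (2 * w).

Definition slope (w : R) (g : R -> R) (x : R) : R :=
  (g (x + w) - g (x - w)) / (2 * w).

Definition lipschitz (L : R) (g : R -> R) : Prop :=
  forall x y, Rabs (g x - g y) <= L * Rabs (x - y).

Lemma lipschitz_continuous (L : R) (g : R -> R) (x : R) :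
  0 <= L -> lipschitz L g -> continuous g x.
Proof.
  intros HL Hg. apply continuity_pt_filterlim. intros e He.
  assert (HL1 : 0 < L + 1) by lra.
  exists (e / (L + 1)). split; [apply Rdiv_lt_0_compat; assumption|].
  intros y [_ Hy]. simpl in *. unfold R_dist in *.
  eapply Rle_lt_trans; [apply Hg|].
  apply Rmult_lt_compat_r with (r := L + 1) in Hy; [|exact HL1].
  replace (e / (L + 1) * (L + 1)) with e in Hy by (field; lra).
  pose proof (Rabs_pos (y - x)). nra.
Qed.

Lemma lipschitz_ex_RInt (L : R) (g : R -> R) (x a b : R) :
  0 <= L -> lipschitz L g -> ex_RInt (fun t => g (x + t)) a b.
Proof.
  intros HL Hg. apply (ex_RInt_continuous (V := R_CompleteNormedModule)).
  intros z _. apply (lipschitz_continuous L); [exact HL|].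
  intros s t. replace (s - t) with ((x + s) - (x + t)) by ring. apply Hg.
Qed.

Lemma average_near (w L e v x : R) (g : R -> R) :
  0 < w -> 0 <= L -> lipschitz L g ->
  (forall t, - w <= t <= w -> Rabs (g (x + t) - v) <= e) ->
  Rabs (average w g x - v) <= e.
Proof.
  intros Hw HL Hg Hv. unfold average.
  assert (Hex := lipschitz_ex_RInt L g x (- w) w HL Hg).
  assert (Hc : ex_RInt (fun _ : R => v) (- w) w) by apply ex_RInt_const.
  assert (Heq : RInt (fun t => g (x + t) - v) (- w) w =
                RInt (fun t => g (x + t)) (- w) w - 2 * w * v).
  { rewrite (RInt_minus (V := R_CompleteNormedModule)) by assumption.
    rewrite RInt_const. unfold minus, plus, opp, scal; simpl; unfold mult; simpl. ring. }
  replace (RInt (fun t => g (x + t)) (- w) w / (2 * w) - v)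
    with (RInt (fun t => g (x + t) - v) (- w) w / (2 * w))
    by (rewrite Heq; field; lra).
  unfold Rdiv. rewrite Rabs_mult, (Rabs_pos_eq (/ _)).
  2: { left. apply Rinv_0_lt_compat. lra. }
  apply Rmult_le_reg_r with (2 * w); [lra|].
  rewrite Rmult_assoc, Rinv_l, Rmult_1_r by lra.
  eapply Rle_trans.
  - apply abs_RInt_le_const with (M := e); [lra| |exact Hv].
    apply (ex_RInt_minus (V := R_NormedModule)); assumption.
  - right. ring.
Qed.

Lemma average_diff (w L x e : R) (g1 g2 : R -> R) :
  0 < w -> 0 <= L -> lipschitz L g1 -> lipschitz L g2 ->
  forall y, (forall t, Rabs (g1 (x + t) - g2 (y + t)) <= e) ->
  Rabs (average w g1 x - average w g2 y) <= e.
Proof.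
  intros Hw HL H1 H2 y He.
  set (g := fun t => g1 (x + t) - g2 (y + t)).
  assert (Hg : lipschitz (2 * L) g).
  { intros s t. unfold g.
    replace (g1 (x + s) - g2 (y + s) - (g1 (x + t) - g2 (y + t))) with
      ((g1 (x + s) - g1 (x + t)) - (g2 (y + s) - g2 (y + t))) by ring.
    eapply Rle_trans; [apply Rabs_triang|]. rewrite Rabs_Ropp.
    specialize (H1 (x + s) (x + t)). specialize (H2 (y + s) (y + t)).
    replace (x + s - (x + t)) with (s - t) in H1 by ring.
    replace (y + s - (y + t)) with (s - t) in H2 by ring. lra. }
  assert (Heq : average w g1 x - average w g2 y = average w g 0 - 0).
  { unfold average, g. rewrite Rminus_0_r. unfold Rdiv.
    rewrite <- Rmult_minus_distr_r. f_equal.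
    rewrite <- (RInt_minus (V := R_CompleteNormedModule)).
    - apply RInt_ext. intros t _. rewrite Rplus_0_l. reflexivity.
    - apply (lipschitz_ex_RInt L); assumption.
    - apply (lipschitz_ex_RInt L); assumption. }
  rewrite Heq. apply (average_near w (2 * L)); auto; [lra|].
  intros t _. rewrite Rminus_0_r, Rplus_0_l. apply He.
Qed.

Lemma average_lipschitz (w L : R) (g : R -> R) :
  0 < w -> 0 <= L -> lipschitz L g -> lipschitz L (average w g).
Proof.
  intros Hw HL Hg x y. apply (average_diff w L); auto.
  intros t. replace (x - y) with ((x + t) - (y + t)) by ring. apply Hg.
Qed.

Lemma slope_derive (w : R) (f df : R -> R) (x : R) :
  (forall y, is_derive f y (df y)) -> is_derive (slope w f) x (slope w df x).
Proof.
  intros Hf. unfold slope.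
  apply is_derive_ext with (fun x => scal (/ (2 * w)) (minus (f (x + w)) (f (x - w)))).
  { intros t. unfold scal, minus, plus, opp; simpl; unfold mult; simpl.
    unfold Rdiv, Rminus. ring. }
  replace ((df (x + w) - df (x - w)) / (2 * w)) with
    (scal (/ (2 * w)) (minus (scal 1 (df (x + w))) (scal 1 (df (x - w))))).
  2: { unfold scal, minus, plus, opp; simpl; unfold mult; simpl.
       unfold Rdiv, Rminus. ring. }
  apply (is_derive_scal (fun x => minus (f (x + w)) (f (x - w)))).
  apply (is_derive_minus (V := R_NormedModule)).
  - apply (is_derive_comp f (fun x => x + w)); [apply Hf|].
    auto_derive; [exact I|ring].
  - apply (is_derive_comp f (fun x => x - w)); [apply Hf|].
    auto_derive; [exact I|ring].
Qed.

Lemma average_derive (w L x : R) (g : R -> R) :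
  0 < w -> 0 <= L -> lipschitz L g -> is_derive (average w g) x (slope w g x).
Proof.
  intros Hw HL Hg.
  set (F := fun x => RInt g 0 x : R).
  assert (Hex : forall a b, ex_RInt g a b).
  { intros a b. apply ex_RInt_ext with (fun t => g (0 + t)).
    - intros t _. f_equal. ring.
    - apply (lipschitz_ex_RInt L); assumption. }
  assert (HF : forall x, is_derive F x (g x)).
  { intros z. apply (is_derive_RInt g F 0 z).
    - apply filter_forall. intros b.
      apply (RInt_correct (V := R_CompleteNormedModule) g), Hex.
    - apply (lipschitz_continuous L); assumption. }
  apply is_derive_ext with (fun x => (F (x + w) - F (x - w)) / (2 * w)).
  { intros z. unfold average. f_equal.
    assert (H : RInt (fun t => g (z + t)) (- w) w = RInt g (z - w) (z + w)).
    { replace (z - w) with (1 * (- w) + z) by ring.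
      replace (z + w) with (1 * w + z) at 1 by ring.
      rewrite <- (RInt_comp_lin (V := R_CompleteNormedModule)) by apply Hex.
      apply RInt_ext. intros t _. unfold scal; simpl; unfold mult; simpl.
      rewrite Rmult_1_l. f_equal. ring. }
    rewrite H. unfold F.
    rewrite <- (RInt_Chasles (V := R_CompleteNormedModule) g 0 (z - w) (z + w))
      by apply Hex.
    unfold plus; simpl. ring. }
  apply (slope_derive w F g). exact HF.
Qed.

Definition trapezoid (r x : R) : R := Rmin 1 (Rmax 0 (2 - Rabs x / r)).

Lemma trapezoid_lipschitz (r : R) : 0 < r -> lipschitz (/ r) (trapezoid r).
Proof.
  intros Hr x y. unfold trapezoid.
  assert (Hclamp : forall a b,
    Rabs (Rmin 1 (Rmax 0 a) - Rmin 1 (Rmax 0 b)) <= Rabs (a - b)).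
  { intros a b.
    assert (Hab : - Rabs (a - b) <= a - b <= Rabs (a - b)) by (apply Rabs_le_between; lra).
    apply Rabs_le. unfold Rmax. destruct (Rle_dec 0 a), (Rle_dec 0 b); unfold Rmin;
      repeat match goal with |- context [if ?d then _ else _] => destruct d end; lra. }
  eapply Rle_trans; [apply Hclamp|].
  replace (2 - Rabs x / r - (2 - Rabs y / r)) with (/ r * (Rabs y - Rabs x))
    by (unfold Rdiv; ring).
  assert (Hi : 0 < / r) by (apply Rinv_0_lt_compat; exact Hr).
  rewrite Rabs_mult, (Rabs_pos_eq (/ r)) by lra.
  apply Rmult_le_compat_l; [lra|]. rewrite (Rabs_minus_sym x y).
  apply Rabs_triang_inv2.
Qed.

Lemma trapezoid_bound (r x : R) : Rabs (trapezoid r x) <= 1.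
Proof.
  unfold trapezoid. apply Rabs_le. split.
  - apply Rmin_glb; [lra|]. eapply Rle_trans; [|apply Rmax_l]. lra.
  - eapply Rle_trans; [apply Rmin_l|]. lra.
Qed.

Lemma trapezoid_in (r x : R) : 0 < r -> Rabs x <= r -> trapezoid r x = 1.
Proof.
  intros Hr Hx. unfold trapezoid.
  assert (Rabs x / r <= 1).
  { apply Rmult_le_reg_r with r; [exact Hr|]. unfold Rdiv.
    rewrite Rmult_assoc, Rinv_l; lra. }
  rewrite Rmax_right, Rmin_left; lra.
Qed.

Lemma trapezoid_out (r x : R) : 0 < r -> 2 * r <= Rabs x -> trapezoid r x = 0.
Proof.
  intros Hr Hx. unfold trapezoid.
  assert (2 <= Rabs x / r).
  { apply Rmult_le_reg_r with r; [exact Hr|]. unfold Rdiv.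
    rewrite Rmult_assoc, Rinv_l; lra. }
  rewrite Rmax_left, Rmin_right; lra.
Qed.

Fixpoint averages (w : nat -> R) (g : R -> R) (k m : nat) : R -> R :=
  match k with
  | O => g
  | S k => average (w m) (averages w g k (S m))
  end.

Definition infinite_average (w : nat -> R) (g : R -> R) (m : nat) (x : R) : R :=
  real (Lim_seq (fun k => averages w g k m x)).

Lemma averages_lipschitz (w : nat -> R) (g : R -> R) (L : R) :
  positive w -> 0 <= L -> lipschitz L g ->
  forall k m, lipschitz L (averages w g k m).
Proof.
  intros Hw HL Hg. induction k as [|k IH]; intros m; [exact Hg|].
  apply average_lipschitz; auto.
Qed.

Lemma averages_bound (w : nat -> R) (g : R -> R) (L : R) :
  positive w -> 0 <= L -> lipschitz L g -> (forall x, Rabs (g x) <= 1) ->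
  forall k m x, Rabs (averages w g k m x) <= 1.
Proof.
  intros Hw HL Hg Hb. induction k as [|k IH]; intros m x; [apply Hb|].
  simpl. rewrite <- (Rminus_0_r (average _ _ _)).
  apply (average_near _ L); auto.
  - apply averages_lipschitz; assumption.
  - intros t _. rewrite Rminus_0_r. apply IH.
Qed.

(** An average of width [w] only looks at distance [w], so a constant value on
    a nested family of sets growing by [w m] at each step is preserved. *)
Lemma averages_const (w : nat -> R) (g : R -> R) (L v : R)
  (A : nat -> R -> Prop) :
  positive w -> 0 <= L -> lipschitz L g ->
  (forall m x t, A m x -> - w m <= t <= w m -> A (S m) (x + t)) ->
  (forall m x, A m x -> g x = v) ->
  forall k m x, A m x -> averages w g k m x = v.
Proof.
  intros Hw HL Hg HA Hv. induction k as [|k IH]; intros m x Hx; [apply (Hv m x Hx)|].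
  simpl. apply Rminus_diag_uniq.
  assert (H : Rabs (average (w m) (averages w g k (S m)) x - v) <= 0).
  { apply (average_near _ L); auto.
    - apply averages_lipschitz; assumption.
    - intros t Ht. rewrite (IH (S m)); [rewrite Rminus_diag, Rabs_R0; lra|].
      apply HA; assumption. }
  pose proof (Rabs_pos (average (w m) (averages w g k (S m)) x - v)).
  apply Rabs_eq_0. lra.
Qed.

Lemma averages_step (w : nat -> R) (g : R -> R) (L : R) :
  positive w -> 0 <= L -> lipschitz L g ->
  forall k m x, Rabs (averages w g (S k) m x - averages w g k m x) <= L * w (m + k)%nat.
Proof.
  intros Hw HL Hg. induction k as [|k IH]; intros m x.
  - simpl. rewrite Nat.add_0_r. apply (average_near _ L); auto.
    intros t Ht. eapply Rle_trans; [apply Hg|].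
    apply Rmult_le_compat_l; [exact HL|].
    replace (x + t - x) with t by ring. apply Rabs_le. lra.
  - apply (average_diff (w m) L x _ (averages w g (S k) (S m))
      (averages w g k (S m)) (Hw m) HL (averages_lipschitz w g L Hw HL Hg _ _)
      (averages_lipschitz w g L Hw HL Hg _ _)).
    intros t. replace (m + S k)%nat with (S m + k)%nat by lia. apply IH.
Qed.

Lemma averages_cauchy (w s : nat -> R) (g : R -> R) (L : R) :
  positive w -> 0 <= L -> lipschitz L g ->
  (forall n, s (S n) = s n + w n) ->
  forall i k m x, Rabs (averages w g (k + i) m x - averages w g k m x) <=
                  L * (s (m + k + i)%nat - s (m + k)%nat).
Proof.
  intros Hw HL Hg Hs. induction i as [|i IH]; intros k m x.
  - rewrite !Nat.add_0_r, !Rminus_diag, Rabs_R0. lra.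
  - rewrite !Nat.add_succ_r, Hs.
    replace (averages w g (S (k + i)) m x - averages w g k m x) with
      ((averages w g (S (k + i)) m x - averages w g (k + i) m x) +
       (averages w g (k + i) m x - averages w g k m x)) by ring.
    eapply Rle_trans; [apply Rabs_triang|].
    specialize (IH k m x).
    pose proof (averages_step w g L Hw HL Hg (k + i) m x) as H.
    rewrite Nat.add_assoc in H. lra.
Qed.

Lemma infinite_average_lim (w s : nat -> R) (g : R -> R) (L l : R) :
  positive w -> 0 <= L -> lipschitz L g ->
  (forall n, s (S n) = s n + w n) -> is_lim_seq s l ->
  forall m x, is_lim_seq (fun k => averages w g k m x) (infinite_average w g m x).
Proof.
  intros Hw HL Hg Hs Hl m x. apply Lim_seq_correct', ex_lim_seq_cauchy_corr.
  assert (Hc : ex_lim_seq_cauchy s).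
  { apply ex_lim_seq_cauchy_corr. exists l; exact Hl. }
  intros e.
  assert (He : 0 < e / (L + 1)) by (apply Rdiv_lt_0_compat; [apply cond_pos|lra]).
  destruct (Hc (mkposreal _ He)) as [P HP]. cbn [pos] in HP.
  exists P.
  assert (Hle : forall n i, (P <= n)%nat ->
    Rabs (averages w g (n + i) m x - averages w g n m x) < e).
  { intros n i Hn. eapply Rle_lt_trans; [apply (averages_cauchy w s g L); auto|].
    specialize (HP (m + n + i)%nat (m + n)%nat ltac:(lia) ltac:(lia)).
    apply Rmult_lt_compat_r with (r := L + 1) in HP; [|lra].
    replace (e / (L + 1) * (L + 1)) with (pos e) in HP by (field; lra).
    eapply Rle_lt_trans; [|exact HP]. rewrite (Rmult_comm _ (L + 1)).
    pose proof (Rle_abs (s (m + n + i)%nat - s (m + n)%nat)).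
    pose proof (Rabs_pos (s (m + n + i)%nat - s (m + n)%nat)). nra. }
  intros n q Hn Hq. destruct (le_lt_dec n q) as [H|H].
  - rewrite Rabs_minus_sym. replace q with (n + (q - n))%nat by lia.
    apply Hle. exact Hn.
  - replace n with (q + (n - q))%nat by lia. apply Hle. exact Hq.
Qed.

Lemma infinite_average_lipschitz (w s : nat -> R) (g : R -> R) (L l : R) :
  positive w -> 0 <= L -> lipschitz L g ->
  (forall n, s (S n) = s n + w n) -> is_lim_seq s l ->
  forall m, lipschitz L (infinite_average w g m).
Proof.
  intros Hw HL Hg Hs Hl m x y.
  assert (H := is_lim_seq_minus' _ _ _ _
    (infinite_average_lim w s g L l Hw HL Hg Hs Hl m x)
    (infinite_average_lim w s g L l Hw HL Hg Hs Hl m y)).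
  apply (is_lim_seq_abs _ (Finite _)) in H. simpl in H.
  apply (is_lim_seq_le _ _ (Finite _) (Finite (L * Rabs (x - y)))
    (fun k => averages_lipschitz w g L Hw HL Hg k m x y) H).
  apply is_lim_seq_const.
Qed.

Lemma infinite_average_fix (w s : nat -> R) (g : R -> R) (L l : R) :
  positive w -> 0 <= L -> lipschitz L g ->
  (forall n, s (S n) = s n + w n) -> is_lim_seq s l ->
  forall m x, infinite_average w g m x =
              average (w m) (infinite_average w g (S m)) x.
Proof.
  intros Hw HL Hg Hs Hl m x.
  assert (Hlim := infinite_average_lim w s g L l Hw HL Hg Hs Hl).
  assert (Hdist : forall k y,
    Rabs (averages w g k (S m) y - infinite_average w g (S m) y) <=
    L * (l - s (S m + k)%nat)).
  { intros k y. rewrite Rabs_minus_sym.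
    assert (H1 : is_lim_seq
      (fun i => Rabs (averages w g (k + i) (S m) y - averages w g k (S m) y))
      (Rabs (infinite_average w g (S m) y - averages w g k (S m) y))).
    { apply (is_lim_seq_abs _ (Finite _)).
      apply is_lim_seq_minus'; [|apply is_lim_seq_const].
      apply is_lim_seq_ext with (fun i => averages w g (i + k) (S m) y).
      - intros i. rewrite Nat.add_comm. reflexivity.
      - apply (is_lim_seq_incr_n (fun i => averages w g i (S m) y)). apply Hlim. }
    assert (H2 : is_lim_seq (fun i => L * (s (S m + k + i)%nat - s (S m + k)%nat))
                            (L * (l - s (S m + k)%nat))).
    { apply (is_lim_seq_scal_l _ L (Finite _)).
      apply is_lim_seq_minus'; [|apply is_lim_seq_const].
      apply is_lim_seq_ext with (fun i => s (i + (S m + k))%nat).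
      - intros i. f_equal. lia.
      - apply (is_lim_seq_incr_n s). exact Hl. }
    apply (is_lim_seq_le _ _ (Finite _) (Finite _)
      (fun i => averages_cauchy w s g L Hw HL Hg Hs i k (S m) y) H1 H2). }
  assert (H1 : is_lim_seq (fun k => averages w g (S k) m x)
                          (infinite_average w g m x)).
  { apply (is_lim_seq_incr_1 (fun k => averages w g k m x)). apply Hlim. }
  assert (H2 : is_lim_seq (fun k => averages w g (S k) m x)
                          (average (w m) (infinite_average w g (S m)) x)).
  { apply is_lim_seq_ext with (fun k => average (w m) (infinite_average w g (S m)) x +
      (averages w g (S k) m x - average (w m) (infinite_average w g (S m)) x)).
    { intros k. ring. }
    rewrite <- (Rplus_0_r (average (w m) (infinite_average w g (S m)) x)) at 1.
    apply is_lim_seq_plus'; [apply is_lim_seq_const|].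
    apply (is_lim_seq_abs_0 _).
    apply is_lim_seq_le_le with (u := fun _ => 0)
      (w := fun k => L * (l - s (S m + k)%nat)).
    - intros k. split; [apply Rabs_pos|].
      simpl averages. apply (average_diff _ L); auto.
      + apply averages_lipschitz; assumption.
      + apply (infinite_average_lipschitz w s g L l); assumption.
    - apply is_lim_seq_const.
    - replace (Finite 0) with (Rbar_mult L (l - l)).
      2: { simpl. f_equal. ring. }
      apply is_lim_seq_scal_l. apply is_lim_seq_minus'; [apply is_lim_seq_const|].
      apply is_lim_seq_ext with (fun i => s (i + S m)%nat).
      + intros i. f_equal. lia.
      + apply (is_lim_seq_incr_n s). exact Hl. }
  apply is_lim_seq_unique in H1. apply is_lim_seq_unique in H2.
  rewrite H1 in H2. injection H2. auto.
Qed.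

(** Since the infinite average starting at [m] is the average of width [w m]
    of the one starting at [m + 1], its derivative is a difference quotient
    of the latter, and so on: no differentiation under a limit is needed. *)
Fixpoint average_jet (w : nat -> R) (g : R -> R) (n m : nat) (x : R) : R :=
  match n with
  | O => infinite_average w g m x
  | S n => slope (w m) (average_jet w g n (S m)) x
  end.

Lemma average_jet_derive (w s : nat -> R) (g : R -> R) (L l : R) :
  positive w -> 0 <= L -> lipschitz L g ->
  (forall n, s (S n) = s n + w n) -> is_lim_seq s l ->
  forall n m x, is_derive (average_jet w g n m) x (average_jet w g (S n) m x).
Proof.
  intros Hw HL Hg Hs Hl. induction n as [|n IH]; intros m x.
  - apply is_derive_ext with (average (w m) (infinite_average w g (S m))).
    + intros t. symmetry. apply (infinite_average_fix w s g L l); assumption.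
    + apply (average_derive _ L); auto.
      apply (infinite_average_lipschitz w s g L l); assumption.
  - change (average_jet w g (S (S n)) m x) with
      (slope (w m) (average_jet w g (S n) (S m)) x).
    change (average_jet w g (S n) m) with (slope (w m) (average_jet w g n (S m))).
    apply slope_derive. intros y. apply IH.
Qed.

Lemma average_jet_bound (w V : nat -> R) (g : R -> R) :
  positive w -> positive V -> (forall n, V (S n) = V n / w n) ->
  (forall m x, Rabs (infinite_average w g m x) <= 1) ->
  forall n m x, Rabs (average_jet w g n m x) <= V (m + n)%nat / V m.
Proof.
  intros Hw HV HVS Hb. induction n as [|n IH]; intros m x.
  - rewrite Nat.add_0_r. unfold Rdiv. rewrite Rinv_r; [apply Hb|].
    apply Rgt_not_eq, HV.
  - simpl. unfold slope. assert (Hwm := Hw m). assert (HVm := HV m).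
    pose proof (IH (S m) (x + w m)) as H1. pose proof (IH (S m) (x - w m)) as H2.
    rewrite HVS in H1, H2. replace (S m + n)%nat with (m + S n)%nat in * by lia.
    unfold Rdiv at 1. rewrite Rabs_mult, (Rabs_pos_eq (/ _)).
    2: { left. apply Rinv_0_lt_compat. lra. }
    apply Rmult_le_reg_r with (2 * w m); [lra|].
    rewrite Rmult_assoc, Rinv_l, Rmult_1_r by lra.
    eapply Rle_trans; [apply Rabs_triang|]. rewrite Rabs_Ropp.
    eapply Rle_trans; [apply Rplus_le_compat; [exact H1|exact H2]|].
    right. field. lra.
Qed.

Lemma infinite_average_const (w : nat -> R) (g : R -> R) (L v : R)
  (A : nat -> R -> Prop) :
  positive w -> 0 <= L -> lipschitz L g ->
  (forall m x t, A m x -> - w m <= t <= w m -> A (S m) (x + t)) ->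
  (forall m x, A m x -> g x = v) ->
  forall m x, A m x -> infinite_average w g m x = v.
Proof.
  intros Hw HL Hg HA Hv m x Hx. unfold infinite_average.
  rewrite (Lim_seq_ext _ (fun _ => v)); [rewrite Lim_seq_const; reflexivity|].
  intros k. apply (averages_const w g L v A); assumption.
Qed.

Lemma average_jet_flat (w : nat -> R) (g : R -> R) (v : R) (A : nat -> R -> Prop) :
  positive w ->
  (forall m x t, A m x -> - w m <= t <= w m -> A (S m) (x + t)) ->
  (forall m x, A m x -> infinite_average w g m x = v) ->
  forall n m x, A m x -> average_jet w g (S n) m x = 0.
Proof.
  intros Hw HA Hv. induction n as [|n IH]; intros m x Hx; assert (Hwm := Hw m).
  - simpl. unfold slope. rewrite !(Hv (S m)).
    + unfold Rdiv. ring.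
    + apply (HA m x (- w m)); [exact Hx|lra].
    + apply HA; [exact Hx|lra].
  - change (slope (w m) (average_jet w g (S n) (S m)) x = 0). unfold slope.
    rewrite !IH.
    + unfold Rdiv. ring.
    + apply (HA m x (- w m)); [exact Hx|lra].
    + apply HA; [exact Hx|lra].
Qed.

(** Smoothing a trapezoid with plateau of radius [4 * z] and support of radius
    [8 * z]: the sum of the widths, at most [3 * z], is what the first radius
    loses and the second one gains. *)
Lemma cutoff (w s V : nat -> R) (z : R) :
  0 < z -> positive w -> s 0%nat = 0 -> (forall n, s (S n) = s n + w n) ->
  (forall n, s n <= 3 * z) -> positive V -> V 0%nat = 1 ->
  (forall n, V (S n) = V n / w n) ->
  exists u, jet u /\ u 0%nat 0 = 1 /\ (forall n, u (S n) 0 = 0) /\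
    (forall n x, 11 * z <= Rabs x -> u n x = 0) /\
    (forall n x, Rabs (u n x) <= V n).
Proof.
  intros Hz Hw Hs0 Hs Hs3 HV HV0 HVS.
  assert (Hincr : forall n, s n <= s (S n)).
  { intros n. rewrite Hs. pose proof (Hw n). lra. }
  destruct (ex_finite_lim_seq_incr s (3 * z) Hincr Hs3) as [l Hl].
  assert (Hsl : forall n, s n <= l).
  { intros n. apply (is_lim_seq_incr_compare s l Hl Hincr). }
  assert (Hl3 : l <= 3 * z).
  { apply (is_lim_seq_le _ _ (Finite _) (Finite _) Hs3 Hl), is_lim_seq_const. }
  set (r := 4 * z). assert (Hr : 0 < r) by (unfold r; lra).
  assert (Hir : 0 <= / r) by (left; apply Rinv_0_lt_compat; exact Hr).
  set (g := trapezoid r). assert (Hg := trapezoid_lipschitz r Hr). fold g in Hg.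
  set (Inner := fun m x => Rabs x <= r - l + s m).
  set (Outer := fun m x => 2 * r + l - s m <= Rabs x).
  assert (HIn : forall m x t, Inner m x -> - w m <= t <= w m -> Inner (S m) (x + t)).
  { unfold Inner. intros m x t Hx Ht. rewrite Hs. eapply Rle_trans; [apply Rabs_triang|].
    assert (Rabs t <= w m) by (apply Rabs_le; lra). lra. }
  assert (HOut : forall m x t, Outer m x -> - w m <= t <= w m -> Outer (S m) (x + t)).
  { unfold Outer. intros m x t Hx Ht. rewrite Hs.
    assert (Rabs t <= w m) by (apply Rabs_le; lra).
    pose proof (Rabs_triang (x + t) (- t)) as H1. rewrite Rabs_Ropp in H1.
    replace (x + t + - t) with x in H1 by ring. lra. }
  assert (HInv := infinite_average_const w g (/ r) 1 Inner Hw Hir Hg HIn).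
  assert (HOutv := infinite_average_const w g (/ r) 0 Outer Hw Hir Hg HOut).
  assert (HIn1 : forall m x, Inner m x -> infinite_average w g m x = 1).
  { apply HInv. intros m x Hx. apply trapezoid_in; [exact Hr|].
    unfold Inner in Hx. specialize (Hsl m). lra. }
  assert (HOut0 : forall m x, Outer m x -> infinite_average w g m x = 0).
  { apply HOutv. intros m x Hx. apply trapezoid_out; [exact Hr|].
    unfold Outer in Hx. specialize (Hsl m). lra. }
  assert (H0 : Inner 0%nat 0) by (unfold Inner, r; rewrite Rabs_R0, Hs0; lra).
  exists (fun n => average_jet w g n 0%nat).
  split; [|split; [|split; [|split]]].
  - intros n x. apply (average_jet_derive w s g (/ r) l); assumption.
  - apply HIn1. exact H0.
  - intros n. apply (average_jet_flat w g 1 Inner); assumption.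
  - intros n x Hx. assert (HxO : Outer 0%nat x) by (unfold Outer, r; rewrite Hs0; lra).
    destruct n as [|n]; [apply HOut0; exact HxO|].
    apply (average_jet_flat w g 0 Outer); assumption.
  - intros n x.
    assert (H := average_jet_bound w V g Hw HV HVS).
    replace (V n) with (V (0 + n)%nat / V 0%nat).
    + apply H. intros m y.
      assert (Hlim := infinite_average_lim w s g (/ r) l Hw Hir Hg Hs Hl m y).
      apply (is_lim_seq_abs _ (Finite _)) in Hlim. simpl in Hlim.
      apply (is_lim_seq_le _ _ (Finite _) (Finite 1)
        (fun k => averages_bound w g (/ r) Hw Hir Hg (trapezoid_bound r) k m y) Hlim).
      apply is_lim_seq_const.
    + rewrite HV0. simpl. field.
Qed.

(** * Functions with a single nonzero Taylor coefficient *)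

(** The jet of [x^i / i! * u].  Multiplying by one factor [x] at a time keeps
    Leibniz' formula to two terms. *)
Fixpoint monomial_jet (u : nat -> R -> R) (i n : nat) (x : R) : R :=
  match i with
  | O => u n x
  | S i => (x * monomial_jet u i n x + INR n * monomial_jet u i (pred n) x)
           / INR (S i)
  end.

Lemma monomial_jet_jet (u : nat -> R -> R) (i : nat) :
  jet u -> jet (monomial_jet u i).
Proof.
  intros Hu. induction i as [|i IH]; [exact Hu|].
  intros n x. set (Q := monomial_jet u i) in *.
  assert (HSi : 0 < INR (S i)) by (apply lt_0_INR; lia).
  apply is_derive_ext with (fun x => scal (/ INR (S i))
    (plus (mult x (Q n x)) (scal (INR n) (Q (pred n) x)))).
  { intros t. unfold scal, plus, mult; simpl monomial_jet; simpl; unfold mult; simpl.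
    unfold Rdiv. fold Q. ring. }
  replace (monomial_jet u (S i) (S n) x) with (scal (/ INR (S i))
    (plus (plus (mult 1 (Q n x)) (mult x (Q (S n) x)))
          (scal (INR n) (Q (S (pred n)) x)))).
  { apply (is_derive_scal (fun x => plus (mult x (Q n x)) (scal (INR n) (Q (pred n) x)))).
    apply (is_derive_plus (V := R_NormedModule)).
    - apply (is_derive_mult (fun x => x) (Q n)); [|apply IH|].
      + apply (is_derive_id (K := R_AbsRing)).
      + intros a b. apply Rmult_comm.
    - apply (is_derive_scal (Q (pred n))). apply IH. }
  change (monomial_jet u (S i) (S n) x) with
    ((x * Q (S n) x + INR (S n) * Q n x) / INR (S i)).
  unfold scal, plus, mult; simpl Hierarchy.plus; unfold scal; cbn -[INR]; unfold mult; cbn -[INR].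
  rewrite (S_INR n). destruct n as [|n].
  - simpl (INR 0). field. lra.
  - rewrite <- pred_Sn. field. lra.
Qed.

Lemma monomial_jet_at_0 (u : nat -> R -> R) :
  u 0%nat 0 = 1 -> (forall n, u (S n) 0 = 0) ->
  forall i n, monomial_jet u i n 0 = if Nat.eq_dec n i then 1 else 0.
Proof.
  intros H0 HS. induction i as [|i IH]; intros n.
  - simpl. destruct n as [|n]; [exact H0|apply HS].
  - assert (HSi : 0 < INR (S i)) by (apply lt_0_INR; lia).
    change ((0 * monomial_jet u i n 0 + INR n * monomial_jet u i (pred n) 0) / INR (S i)
       = if Nat.eq_dec n (S i) then 1 else 0).
    rewrite (IH (pred n)). destruct n as [|n].
    + simpl (INR 0). destruct (Nat.eq_dec 0 (S i)); [lia|]. unfold Rdiv. ring.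
    + rewrite <- pred_Sn. destruct (Nat.eq_dec n i) as [->|H].
      * destruct (Nat.eq_dec (S i) (S i)); [|lia]. field. lra.
      * destruct (Nat.eq_dec (S n) (S i)); [lia|]. unfold Rdiv. ring.
Qed.

Lemma monomial_jet_out (u : nat -> R -> R) (x : R) :
  (forall n, u n x = 0) -> forall i n, monomial_jet u i n x = 0.
Proof.
  intros H. induction i as [|i IH]; intros n; [apply H|].
  change ((x * monomial_jet u i n x + INR n * monomial_jet u i (pred n) x) / INR (S i)
       = 0).
  rewrite !IH. unfold Rdiv. ring.
Qed.

Lemma pow_div_fact_le_exp (y : R) (i : nat) :
  0 <= y -> y ^ i / INR (fact i) <= exp y.
Proof.
  intros Hy. rewrite <- (Rmult_1_l (y ^ i / _)).
  apply (fun A1 A2 A3 => taylor_lower_bound (fun _ => exp) i 1 y A1 A2 A3 i).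
  - intros n x. apply is_derive_exp.
  - intros j _. rewrite exp_0. lra.
  - intros x Hx. pose proof (exp_ineq1_le x). lra.
  - lia.
  - lra.
Qed.

(** With [|x| <= al * w] on the support, a factor [x] costs [al * w] and a
    derivative falling on a monomial is compensated by [w] as well; the [i]
    factors [al + n * ka] thus collected, divided by [i!], stay below
    [exp (al + n * ka)]. *)
Lemma monomial_jet_bound (u : nat -> R -> R) (V : nat -> R) (w al ka : R) :
  0 <= w -> 0 <= al -> 0 <= ka -> positive V ->
  (forall n, V n <= ka * w * V (S n)) ->
  (forall n x, Rabs (u n x) <= V n) ->
  (forall n x, al * w <= Rabs x -> u n x = 0) ->
  forall i n x, Rabs (monomial_jet u i n x) <= w ^ i * exp (al + INR n * ka) * V n.
Proof.
  intros Hw Hal Hka HV HVS Hb Hout i n x.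
  assert (Hy : forall n, 0 <= al + INR n * ka).
  { intros q. pose proof (pos_INR q). nra. }
  apply Rle_trans with (w ^ i * ((al + INR n * ka) ^ i / INR (fact i)) * V n).
  2: { apply Rmult_le_compat_r; [left; apply HV|].
       apply Rmult_le_compat_l; [apply pow_le; exact Hw|].
       apply pow_div_fact_le_exp, Hy. }
  destruct (Rle_lt_dec (al * w) (Rabs x)) as [Hx|Hx].
  { rewrite monomial_jet_out by (intros q; apply Hout; exact Hx). rewrite Rabs_R0.
    apply Rmult_le_pos; [|left; apply HV]. apply Rmult_le_pos; [apply pow_le; exact Hw|].
    apply Rdiv_le_0_compat; [apply pow_le, Hy|apply INR_fact_lt_0]. }
  revert n. induction i as [|i IH]; intros n.
  - simpl. rewrite Rdiv_1_r, !Rmult_1_l. apply Hb.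
  - change (monomial_jet u (S i) n x) with
      ((x * monomial_jet u i n x + INR n * monomial_jet u i (pred n) x) / INR (S i)).
    assert (HSi : 0 < INR (S i)) by (apply lt_0_INR; lia).
    assert (Hf := INR_fact_lt_0 i).
    set (E := w ^ i * ((al + INR n * ka) ^ i / INR (fact i))).
    assert (HE : 0 <= E).
    { unfold E. apply Rmult_le_pos; [apply pow_le; exact Hw|].
      apply Rdiv_le_0_compat; [apply pow_le, Hy|exact Hf]. }
    assert (H1 : Rabs (x * monomial_jet u i n x) <= (al * w) * (E * V n)).
    { rewrite Rabs_mult. apply Rmult_le_compat; try apply Rabs_pos; [lra|apply IH]. }
    assert (H2 : Rabs (INR n * monomial_jet u i (pred n) x) <=
                 INR n * (E * (ka * w * V n))).
    { rewrite Rabs_mult, (Rabs_pos_eq (INR n)) by apply pos_INR.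
      destruct n as [|n]; [simpl (INR 0); lra|].
      apply Rmult_le_compat_l; [apply pos_INR|]. rewrite <- pred_Sn.
      eapply Rle_trans; [apply IH|].
      apply Rmult_le_compat; [|left; apply HV| |apply HVS].
      - apply Rmult_le_pos; [apply pow_le; exact Hw|].
        apply Rdiv_le_0_compat; [apply pow_le, Hy|exact Hf].
      - unfold E. apply Rmult_le_compat_l; [apply pow_le; exact Hw|].
        apply Rmult_le_compat_r; [left; apply Rinv_0_lt_compat; exact Hf|].
        apply pow_incr. split; [apply Hy|]. rewrite (S_INR n). nra. }
    unfold Rdiv at 1. rewrite Rabs_mult, (Rabs_pos_eq (/ _)).
    2: { left. apply Rinv_0_lt_compat. exact HSi. }
    apply Rmult_le_reg_r with (INR (S i)); [exact HSi|].
    rewrite Rmult_assoc, Rinv_l, Rmult_1_r by lra.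
    eapply Rle_trans; [apply Rabs_triang|].
    eapply Rle_trans; [apply Rplus_le_compat; [exact H1|exact H2]|].
    right. unfold E. rewrite fact_simpl, mult_INR. simpl pow. field. lra.
Qed.

(** * Summing the blocks *)

Lemma taylor_remainder_bound (f df ddf : R -> R) (b x y : R) :
  (forall z, is_derive f z (df z)) -> (forall z, is_derive df z (ddf z)) ->
  (forall z, Rabs (ddf z) <= b) ->
  Rabs (f y - f x - (y - x) * df x) <= b * (y - x) ^ 2.
Proof.
  intros Hf Hdf Hb.
  assert (Hmvt : forall g dg : R -> R, (forall z, is_derive g z (dg z)) ->
    forall a, exists e, Rabs (e - x) <= Rabs (a - x) /\ g a - g x = dg e * (a - x)).
  { intros g dg Hg a. destruct (MVT_gen g x a dg) as [e [He Heq]].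
    - intros z _. apply Hg.
    - intros z _. apply derivable_continuous_pt. exists (dg z).
      apply is_derive_Reals, Hg.
    - exists e. split; [|exact Heq]. unfold Rmin, Rmax in He.
      destruct (Rle_dec x a); unfold Rabs;
        destruct (Rcase_abs (e - x)), (Rcase_abs (a - x)); lra. }
  destruct (Hmvt f df Hf y) as [e [He Heq]].
  destruct (Hmvt df ddf Hdf e) as [e' [_ Heq']].
  replace (f y - f x - (y - x) * df x) with ((df e - df x) * (y - x))
    by (rewrite Heq; ring).
  rewrite Heq', !Rabs_mult, <- (pow2_abs (y - x)). simpl. rewrite Rmult_1_r.
  rewrite <- Rmult_assoc. apply Rmult_le_compat_r; [apply Rabs_pos|].
  apply Rmult_le_compat; try apply Rabs_pos; [apply Hb|exact He].
Qed.

Lemma ex_series_half (b : R) : ex_series (fun p => b * (1 / 2) ^ p).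
Proof.
  apply (ex_series_scal (V := R_NormedModule) b).
  exists (/ (1 - 1 / 2)). apply is_series_geom. rewrite Rabs_pos_eq; lra.
Qed.

Lemma Series_half_bound (a : nat -> R) (b : R) :
  (forall p, Rabs (a p) <= b * (1 / 2) ^ p) ->
  ex_series a /\ Rabs (Series a) <= 2 * b.
Proof.
  intros Ha.
  assert (Hex : ex_series (fun p => Rabs (a p))).
  { apply (ex_series_le (V := R_CompleteNormedModule) _ (fun p => b * (1 / 2) ^ p)).
    - intros p. unfold norm; simpl; unfold abs; simpl. rewrite Rabs_Rabsolu. apply Ha.
    - apply ex_series_half. }
  split; [apply ex_series_Rabs; exact Hex|].
  eapply Rle_trans; [apply Series_Rabs; exact Hex|].
  eapply Rle_trans; [apply Series_le; [|apply ex_series_half]|].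
  - intros p. split; [apply Rabs_pos|apply Ha].
  - rewrite Series_scal_l. change (b * Series (fun p => (1 / 2) ^ p) <= 2 * b).
    rewrite Series_geom by (rewrite Rabs_pos_eq; lra). right. field.
Qed.

(** Term-by-term differentiation: the second derivatives are summable
    uniformly, so the remainders in the definition of the derivative are. *)
Lemma jet_series (v : nat -> nat -> R -> R) (B : nat -> R) :
  (forall p, jet (v p)) ->
  (forall p n x, Rabs (v p n x) <= B n * (1 / 2) ^ p) ->
  jet (fun n x => Series (fun p => v p n x)).
Proof.
  intros Hv HB n x.
  assert (Hex : forall n x, ex_series (fun p => v p n x)).
  { intros q z. apply (Series_half_bound _ (B q)). intros p. apply HB. }
  apply is_derive_Reals. intros e He.
  set (b := 2 * B (S (S n))).
  assert (Hb : 0 <= b).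
  { unfold b. specialize (HB 0%nat (S (S n)) 0). simpl in HB.
    pose proof (Rabs_pos (v 0%nat (S (S n)) 0)). lra. }
  assert (Hd : 0 < e / (b + 1)) by (apply Rdiv_lt_0_compat; lra).
  exists (mkposreal _ Hd). intros h Hh0 Hh. cbn [pos] in Hh.
  assert (Heq : Series (fun p => v p n (x + h)) - Series (fun p => v p n x) -
                h * Series (fun p => v p (S n) x) =
                Series (fun p => v p n (x + h) - v p n x - h * v p (S n) x)).
  { rewrite <- Series_scal_l, <- !Series_minus; auto.
    - apply (ex_series_minus (V := R_NormedModule)); apply Hex.
    - apply (ex_series_scal (V := R_NormedModule)), Hex. }
  assert (Hrem : Rabs (Series (fun p => v p n (x + h) - v p n x - h * v p (S n) x)) <=
                 2 * (B (S (S n)) * h ^ 2)).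
  { apply Series_half_bound. intros p.
    assert (H := taylor_remainder_bound (v p n) (v p (S n)) (v p (S (S n)))
      (B (S (S n)) * (1 / 2) ^ p) x (x + h) (Hv p n) (Hv p (S n))
      (fun z => HB p (S (S n)) z)).
    replace (x + h - x) with h in H by ring. lra. }
  rewrite <- Heq in Hrem.
  set (D := Series (fun p => v p n (x + h)) - Series (fun p => v p n x)) in *.
  replace (D / h - Series (fun p => v p (S n) x)) with
    ((D - h * Series (fun p => v p (S n) x)) / h) by (field; exact Hh0).
  unfold Rdiv. rewrite Rabs_mult, Rabs_inv.
  assert (Hh1 : 0 < Rabs h) by (apply Rabs_pos_lt; exact Hh0).
  apply Rmult_lt_reg_r with (Rabs h); [exact Hh1|].
  rewrite Rmult_assoc, Rinv_l, Rmult_1_r by lra.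
  eapply Rle_lt_trans; [exact Hrem|]. rewrite <- (pow2_abs h).
  replace (2 * (B (S (S n)) * Rabs h ^ 2)) with (b * Rabs h * Rabs h)
    by (unfold b; ring).
  apply Rmult_lt_compat_r; [exact Hh1|].
  apply Rmult_lt_compat_r with (r := b + 1) in Hh; [|lra].
  replace (e / (b + 1) * (b + 1)) with e in Hh by (field; lra). nra.
Qed.

Lemma Series_single (a : nat -> R) (n : nat) :
  (forall p, p <> n -> a p = 0) -> Series a = a n.
Proof.
  intros Ha.
  assert (Hz : forall b : nat -> R, (forall p, b p = 0) -> is_series b 0).
  { intros b Hb. apply is_series_ext with (fun p => 0 * (1 / 2) ^ p).
    - intros p. rewrite Hb. apply Rmult_0_l.
    - assert (Hhalf : Rabs (1 / 2) < 1) by (rewrite Rabs_pos_eq; lra).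
      assert (H := is_series_scal (V := R_NormedModule) 0 _ _
        (is_series_geom (1 / 2) Hhalf)).
      replace (scal (K := R_AbsRing) (V := R_NormedModule) 0 (/ (1 - 1 / 2))) with 0 in H
        by (symmetry; apply Rmult_0_l).
      exact H. }
  assert (Htail : is_series (fun k => a (S n + k)%nat) 0).
  { apply Hz. intros p. apply Ha. lia. }
  rewrite (Series_incr_n a (S n)); [|lia|].
  2: { apply (ex_series_incr_n a (S n)). exists 0. exact Htail. }
  rewrite (is_series_unique _ _ Htail), Rplus_0_r. simpl pred.
  destruct n as [|n]; [reflexivity|]. simpl.
  rewrite (sum_eq a (fun _ => 0)), sum_cte by (intros i Hi; apply Ha; lia). ring.
Qed.

(** * The extension operator *)

(** The factors by which the widths [1 / nu_j] of the averages are stretched;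
    they divide the [n]-th derivative by [d_1 ... d_n].  Constant factors give
    functions in the union of the spaces, unbounded factors give functions in
    the intersection.  Since [1 / nu_j = t_j - t_(j+1)], the condition on the
    tails reads [d_j / nu_j <= 2 d_j t_j - 2 d_(j+1) t_(j+1)], so that
    [sum_(j >= p) d_j / nu_j] telescopes to at most [2 d_p t_p]. *)
Record stretching (N d : nat -> R) : Prop := {
  stretch_pos : positive d;
  stretch_incr : forall j, d j <= d (S j);
  stretch_tail : forall j,
    2 * (d (S j) * tail N (S j)) <= d j * (tail N j + tail N (S j));
  stretch_support : 11 * (d 0%nat * tail N 0) <= 1 }.

Fixpoint stretch_prod (d : nat -> R) (n : nat) : R :=
  match n with O => 1 | S n => stretch_prod d n * d (S n) end.

Lemma stretch_prod_pos (d : nat -> R) : positive d -> positive (stretch_prod d).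
Proof.
  intros Hd n. induction n as [|n IH]; simpl; [lra|].
  apply Rmult_lt_0_compat; [exact IH|apply Hd].
Qed.

Lemma stretch_mono (N d : nat -> R) : stretching N d ->
  forall p q, (p <= q)%nat -> d p <= d q.
Proof.
  intros Hd p q Hpq. induction Hpq as [|q Hpq IH]; [lra|].
  pose proof (stretch_incr N d Hd q). lra.
Qed.

Lemma stretch_tail_mono (N d : nat -> R) (c : R) : moderate N c -> stretching N d ->
  forall p q, (p <= q)%nat -> d q * tail N q <= d p * tail N p.
Proof.
  intros HN Hd p q Hpq. induction Hpq as [|q Hpq IH]; [lra|].
  pose proof (stretch_tail N d Hd q) as H.
  pose proof (tail_mono N c HN q (S q) ltac:(lia)).
  pose proof (stretch_pos N d Hd q). nra.
Qed.

(** For the coefficient of order [p].  Among [p] widths with sum [d_p t_p],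
    equal ones have the smallest product of inverses; beyond order [p] the
    widths make the derivatives grow like [N_n]. *)
Definition width (N d : nat -> R) (p j : nat) : R :=
  if le_lt_dec p j then d (S j) / nu N (S j) else d p * tail N p / INR p.

Fixpoint partial_width (N d : nat -> R) (p n : nat) : R :=
  match n with O => 0 | S n => partial_width N d p n + width N d p n end.

Fixpoint inv_width_prod (N d : nat -> R) (p n : nat) : R :=
  match n with O => 1 | S n => inv_width_prod N d p n / width N d p n end.

Lemma width_pos (N d : nat -> R) (c : R) (p : nat) :
  moderate N c -> stretching N d -> positive (width N d p).
Proof.
  intros HN Hd j. unfold width. destruct (le_lt_dec p j) as [H|H].
  - apply Rdiv_lt_0_compat; [apply (stretch_pos N d Hd)|].
    apply nu_pos, (weight_pos N c HN).
  - apply Rdiv_lt_0_compat; [|apply lt_0_INR; lia].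
    apply Rmult_lt_0_compat; [apply (stretch_pos N d Hd)|apply (tail_pos N c HN)].
Qed.

Lemma inv_width_prod_pos (N d : nat -> R) (c : R) (p : nat) :
  moderate N c -> stretching N d -> positive (inv_width_prod N d p).
Proof.
  intros HN Hd n. induction n as [|n IH]; simpl; [lra|].
  apply Rdiv_lt_0_compat; [exact IH|apply (width_pos N d c p HN Hd)].
Qed.

Lemma partial_width_le (N d : nat -> R) (c : R) (p n : nat) :
  moderate N c -> stretching N d ->
  partial_width N d p n <= 3 * (d p * tail N p).
Proof.
  intros HN Hd. set (z := d p * tail N p).
  assert (Hz : 0 < z).
  { apply Rmult_lt_0_compat; [apply (stretch_pos N d Hd)|apply (tail_pos N c HN)]. }
  assert (Hlow : forall n, (n <= p)%nat -> partial_width N d p n = INR n * (z / INR p)).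
  { induction n0 as [|q IH]; intros Hq; [simpl; ring|].
    simpl partial_width. rewrite IH by lia. unfold width.
    destruct (le_lt_dec p q); [lia|]. fold z. rewrite S_INR. ring. }
  assert (Hp : partial_width N d p p <= z).
  { rewrite Hlow by lia. destruct p as [|p]; [simpl; lra|].
    assert (0 < INR (S p)) by (apply lt_0_INR; lia). right. field. lra. }
  assert (Hhigh : forall k, partial_width N d p (p + k) +
    2 * (d (S (p + k)) * tail N (S (p + k))) <= z + 2 * z).
  { induction k as [|k IH].
    - rewrite Nat.add_0_r.
      pose proof (stretch_tail_mono N d c HN Hd p (S p) ltac:(lia)) as H. fold z in H. lra.
    - rewrite Nat.add_succ_r. set (q := (p + k)%nat) in *.
      simpl partial_width. unfold width. destruct (le_lt_dec p q); [|unfold q in *; lia].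
      pose proof (stretch_tail N d Hd (S q)) as H.
      pose proof (tail_S N c HN (S q)) as HS. unfold Rdiv.
      assert (/ nu N (S q) = tail N (S q) - tail N (S (S q))) by lra. nra. }
  destruct (le_lt_dec n p) as [Hn|Hn].
  - rewrite Hlow by exact Hn. apply Rle_trans with (INR p * (z / INR p)).
    + apply Rmult_le_compat_r; [|apply le_INR; exact Hn].
      destruct p as [|p].
      * simpl. unfold Rdiv. rewrite Rinv_0. lra.
      * apply Rdiv_le_0_compat; [lra|apply lt_0_INR; lia].
    + rewrite <- (Hlow p) by lia. lra.
  - specialize (Hhigh (n - p)%nat). replace (p + (n - p))%nat with n in Hhigh by lia.
    pose proof (stretch_pos N d Hd (S n)). pose proof (tail_pos N c HN (S n)). nra.
Qed.

Lemma width_le (N d : nat -> R) (c : R) (p j : nat) :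
  moderate N c -> stretching N d -> (1 <= p)%nat ->
  width N d p j <= (1 + c) * (d p * tail N p / INR p).
Proof.
  intros HN Hd Hp. assert (Hc := const_pos N c HN).
  assert (Hp0 : 0 < INR p) by (apply lt_0_INR; lia).
  assert (Hz : 0 < d p * tail N p).
  { apply Rmult_lt_0_compat; [apply (stretch_pos N d Hd)|apply (tail_pos N c HN)]. }
  assert (Hzp : 0 < d p * tail N p / INR p) by (apply Rdiv_lt_0_compat; assumption).
  unfold width. destruct (le_lt_dec p j) as [H|H]; [|nra].
  set (q := S j). assert (Hpq : (p <= q)%nat) by (unfold q; lia).
  assert (Hdq := stretch_pos N d Hd q).
  pose proof (inv_nu_le N c HN q ltac:(unfold q; lia)) as H1.
  pose proof (tail_mono N c HN q (S q) ltac:(lia)) as H2.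
  pose proof (stretch_tail_mono N d c HN Hd p q Hpq) as H3.
  assert (Hq : INR p <= INR q) by (apply le_INR; exact Hpq).
  apply Rle_trans with (d q * (c * tail N q / INR q)).
  { apply Rmult_le_compat_l; [lra|]. eapply Rle_trans; [exact H1|].
    apply Rmult_le_compat_r; [left; apply Rinv_0_lt_compat; lra|].
    apply Rmult_le_compat_l; lra. }
  apply Rle_trans with (c * (d p * tail N p / INR p)); [|nra].
  apply Rle_trans with (c * (d q * tail N q / INR q)).
  { right. field. lra. }
  apply Rmult_le_compat_l; [lra|]. apply Rmult_le_compat; [|left; apply Rinv_0_lt_compat; lra|exact H3|].
  - pose proof (tail_pos N c HN q). nra.
  - apply Rinv_le_contravar; assumption.
Qed.

(** The size of the coefficient against the widths.  For [n <= p] this is the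
    comparison of the descendant with [L^s]; beyond [p] both sides acquire the
    factor [nu_(n+1) / d_(n+1)] at each step. *)
Lemma block_weight (N d : nat -> R) (c : R) (p n : nat) :
  moderate N c -> stretching N d ->
  descendant N p * ((d p * tail N p / INR p) ^ p * inv_width_prod N d p n) <=
  (tau N 1 * d p) ^ p * (N n / stretch_prod d n).
Proof.
  intros HN Hd. set (w := d p * tail N p / INR p).
  assert (HU := stretch_prod_pos d (stretch_pos N d Hd)).
  assert (Hdp := stretch_pos N d Hd p). assert (Htp := tail_pos N c HN p).
  assert (Ht1 := tau_pos N c HN 1).
  assert (Hw : (1 <= p)%nat -> 0 < w).
  { intros Hp. unfold w. apply Rdiv_lt_0_compat; [nra|apply lt_0_INR; lia]. }
  assert (HV : forall n, (n <= p)%nat -> w ^ p * inv_width_prod N d p n = w ^ (p - n)).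
  { induction n0 as [|q IH]; intros Hq; [rewrite Nat.sub_0_r; simpl; ring|].
    specialize (IH ltac:(lia)). simpl inv_width_prod. unfold width at 1.
    destruct (le_lt_dec p q); [lia|]. fold w. specialize (Hw ltac:(lia)).
    replace (p - q)%nat with (S (p - S q)) in IH by lia. simpl pow in IH.
    replace (w ^ p * (inv_width_prod N d p q / w)) with
      (w ^ p * inv_width_prod N d p q / w) by (field; lra).
    rewrite IH. field. lra. }
  assert (Hprod : forall n, (n <= p)%nat -> stretch_prod d n <= d p ^ n).
  { induction n0 as [|q IH]; intros Hq; [simpl; lra|]. simpl.
    rewrite (Rmult_comm (d p)). apply Rmult_le_compat; [left; apply HU|
      left; apply (stretch_pos N d Hd)|apply IH; lia|].
    apply (stretch_mono N d Hd). exact Hq. }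
  assert (Hlow : forall n, (n <= p)%nat ->
    descendant N p * (w ^ p * inv_width_prod N d p n) <=
    (tau N 1 * d p) ^ p * (N n / stretch_prod d n)).
  { intros q Hq. rewrite HV by exact Hq.
    assert (HNq := weight_pos N c HN q). specialize (Hprod q Hq). specialize (HU q).
    assert (Hdq : 0 < d p ^ q) by (apply pow_lt; exact Hdp).
    assert (Ht1p : 0 < tau N 1 ^ p) by (apply pow_lt; exact Ht1).
    assert (Hw0 : 0 <= w ^ (p - q)).
    { destruct p as [|p]; [simpl; lra|]. apply pow_le. left. apply Hw. lia. }
    assert (Hcancel : (INR p / tail N p) ^ (p - q) * w ^ (p - q) = d p ^ (p - q)).
    { rewrite <- Rpow_mult_distr. destruct p as [|p]; [reflexivity|]. f_equal.
      unfold w. assert (0 < INR (S p)) by (apply lt_0_INR; lia). field. lra. }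
    apply Rle_trans with (tau N 1 ^ p * ((INR p / tail N p) ^ (p - q) * N q) * w ^ (p - q)).
    { apply Rmult_le_compat_r; [exact Hw0|apply (descendant_le N c HN); exact Hq]. }
    replace (tau N 1 ^ p * ((INR p / tail N p) ^ (p - q) * N q) * w ^ (p - q)) with
      (tau N 1 ^ p * ((INR p / tail N p) ^ (p - q) * w ^ (p - q)) * N q) by ring.
    rewrite Hcancel, Rpow_mult_distr.
    replace (d p ^ p) with (d p ^ (p - q) * d p ^ q) by (rewrite <- pow_add; f_equal; lia).
    rewrite !Rmult_assoc. apply Rmult_le_compat_l; [lra|].
    apply Rmult_le_compat_l; [apply pow_le; lra|].
    apply Rmult_le_reg_r with (stretch_prod d q); [exact HU|].
    replace (d p ^ q * (N q / stretch_prod d q) * stretch_prod d q) with (N q * d p ^ q)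
      by (field; lra).
    apply Rmult_le_compat_l; lra. }
  destruct (le_lt_dec n p) as [Hn|Hn]; [apply Hlow; exact Hn|].
  replace n with (p + (n - p))%nat by lia. generalize (n - p)%nat. clear n Hn.
  induction n as [|k IH]; [rewrite Nat.add_0_r; apply Hlow; lia|].
  rewrite Nat.add_succ_r. set (q := (p + k)%nat) in *.
  rewrite (weight_S N q (weight_pos N c HN)). simpl inv_width_prod. simpl stretch_prod.
  unfold width. destruct (le_lt_dec p q); [|unfold q in *; lia].
  assert (Hnu := nu_pos N (weight_pos N c HN) (S q)).
  assert (HdS := stretch_pos N d Hd (S q)). specialize (HU q).
  apply Rle_trans with (descendant N p * (w ^ p * inv_width_prod N d p q) *
                        (nu N (S q) / d (S q))).
  { right. field. lra. }
  eapply Rle_trans; [apply Rmult_le_compat_r; [|exact IH]|].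
  { left. apply Rdiv_lt_0_compat; assumption. }
  right. field. lra.
Qed.

(** The function [x^p / p! * chi_p], where the support of the cutoff function
    [chi_p] has radius [11 * d_p * t_p].  The factor [d_p^p] in the bound is
    what makes a series of such functions converge for small [d_p]. *)
Lemma block_exists (N d : nat -> R) (c : R) (p : nat) :
  moderate N c -> stretching N d ->
  exists v, jet v /\
    (forall n, v n 0 = if Nat.eq_dec n p then 1 else 0) /\
    (forall n x, 1 <= Rabs x -> v n x = 0) /\
    (forall n x, descendant N p * Rabs (v n x) <=
       (exp 11 * tau N 1 * d p) ^ p * (exp (1 + c) ^ n * N n / stretch_prod d n)).
Proof.
  intros HN Hd. set (z := d p * tail N p). assert (Hc := const_pos N c HN).
  assert (Hz : 0 < z).
  { apply Rmult_lt_0_compat; [apply (stretch_pos N d Hd)|apply (tail_pos N c HN)]. }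
  assert (Hwp := width_pos N d c p HN Hd).
  assert (HVp := inv_width_prod_pos N d c p HN Hd).
  destruct (cutoff (width N d p) (partial_width N d p) (inv_width_prod N d p) z)
    as [u [Hu [Hu0 [HuS [Hout Hub]]]]]; auto.
  { intros n. apply (partial_width_le N d c p n HN Hd). }
  exists (monomial_jet u p). split; [|split; [|split]].
  - apply monomial_jet_jet. exact Hu.
  - apply monomial_jet_at_0; assumption.
  - intros n x Hx. apply monomial_jet_out. intros q. apply Hout.
    eapply Rle_trans; [|exact Hx].
    pose proof (stretch_support N d Hd).
    pose proof (stretch_tail_mono N d c HN Hd 0 p ltac:(lia)) as H1. fold z in H1. lra.
  - intros n x.
    assert (Hb : Rabs (monomial_jet u p n x) <=
      (z / INR p) ^ p * exp (11 * INR p + INR n * (1 + c)) * inv_width_prod N d p n).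
    { destruct p as [|p].
      - simpl (INR 0). rewrite Rmult_0_r, Rplus_0_l. simpl pow. simpl monomial_jet.
        rewrite Rmult_1_l. eapply Rle_trans; [apply Hub|].
        rewrite <- (Rmult_1_l (inv_width_prod N d 0 n)) at 1.
        apply Rmult_le_compat_r; [left; apply HVp|].
        pose proof (exp_ineq1_le (INR n * (1 + c))). pose proof (pos_INR n). nra.
      - assert (Hp0 : 0 < INR (S p)) by (apply lt_0_INR; lia).
        apply monomial_jet_bound; try lra; auto.
        + left. apply Rdiv_lt_0_compat; assumption.
        + intros q. assert (Hq := width_le N d c (S p) q HN Hd ltac:(lia)).
          assert (Hwq := Hwp q). fold z in Hq. simpl inv_width_prod.
          assert (HVq := HVp q).
          apply Rle_trans with (width N d (S p) q *
            (inv_width_prod N d (S p) q / width N d (S p) q)).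
          * right. field. lra.
          * apply Rmult_le_compat_r; [|exact Hq].
            left. apply Rdiv_lt_0_compat; assumption.
        + intros q y Hy. apply Hout.
          replace (11 * INR (S p) * (z / INR (S p))) with (11 * z) in Hy
            by (field; lra). exact Hy. }
    assert (HSp := descendant_pos N c HN p).
    eapply Rle_trans; [apply Rmult_le_compat_l; [lra|exact Hb]|].
    assert (Hexp : forall y q, exp (INR q * y) = exp y ^ q).
    { intros y q. rewrite <- Rpower_pow by apply exp_pos. unfold Rpower.
      rewrite ln_exp. reflexivity. }
    rewrite exp_plus, (Rmult_comm 11), !Hexp.
    assert (H := block_weight N d c p n HN Hd). fold z in H.
    apply Rle_trans with (exp 11 ^ p * exp (1 + c) ^ n *
      ((tau N 1 * d p) ^ p * (N n / stretch_prod d n))).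
    + apply Rle_trans with (exp 11 ^ p * exp (1 + c) ^ n *
        (descendant N p * ((z / INR p) ^ p * inv_width_prod N d p n))).
      * right. ring.
      * apply Rmult_le_compat_l; [|exact H].
        apply Rmult_le_pos; apply pow_le; left; apply exp_pos.
    + right. rewrite !Rpow_mult_distr. unfold Rdiv. ring.
Qed.

(** The factor [2] in the hypothesis makes the blocks decay like [2^(-p)]. *)
Lemma real_extension (N d a : nat -> R) (c A : R) :
  moderate N c -> stretching N d ->
  (forall p, Rabs (a p) * (2 * exp 11 * tau N 1 * d p) ^ p <= A * descendant N p) ->
  exists u, jet u /\ (forall n, u n 0 = a n) /\
    (forall n x, 1 <= Rabs x -> u n x = 0) /\
    (forall n x, Rabs (u n x) <= 2 * (A * (exp (1 + c) ^ n * N n / stretch_prod d n))).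
Proof.
  intros HN Hd Ha.
  assert (Hv := fun p => constructive_indefinite_description _ (block_exists N d c p HN Hd)).
  set (v := fun p => proj1_sig (Hv p)).
  assert (Hvp : forall p, _) by (exact (fun p => proj2_sig (Hv p))).
  fold v in Hvp. cbn beta in Hvp.
  set (B := fun n => A * (exp (1 + c) ^ n * N n / stretch_prod d n)).
  assert (HB : forall p n x, Rabs (a p * v p n x) <= B n * (1 / 2) ^ p).
  { intros p n x. destruct (Hvp p) as [_ [_ [_ Hb]]]. specialize (Hb n x).
    specialize (Ha p). fold (v p) in Hb.
    set (E := exp (1 + c) ^ n * N n / stretch_prod d n) in *.
    assert (HE : 0 < E).
    { unfold E. apply Rdiv_lt_0_compat.
      - apply Rmult_lt_0_compat; [apply pow_lt, exp_pos|apply (weight_pos N c HN)].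
      - apply stretch_prod_pos, (stretch_pos N d Hd). }
    assert (HSp := descendant_pos N c HN p).
    set (K := exp 11 * tau N 1 * d p) in *.
    assert (HK : 0 < K ^ p).
    { apply pow_lt. unfold K. repeat apply Rmult_lt_0_compat; [apply exp_pos|
        apply (tau_pos N c HN)|apply (stretch_pos N d Hd)]. }
    replace (2 * exp 11 * tau N 1 * d p) with (2 * K) in Ha by (unfold K; ring).
    rewrite Rpow_mult_distr in Ha.
    assert (H2 : 0 < 2 ^ p) by (apply pow_lt; lra).
    rewrite Rabs_mult. unfold B. fold E.
    replace ((1 / 2) ^ p) with (/ 2 ^ p).
    2: { rewrite <- pow_inv. f_equal. lra. }
    apply Rmult_le_reg_r with (descendant N p * (2 ^ p * K ^ p)).
    { repeat apply Rmult_lt_0_compat; assumption. }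
    apply Rle_trans with ((Rabs (a p) * (2 ^ p * K ^ p)) *
                          (descendant N p * Rabs (v p n x))); [right; ring|].
    apply Rle_trans with ((A * descendant N p) * (K ^ p * E)).
    - apply Rmult_le_compat; [| |exact Ha|exact Hb].
      + apply Rmult_le_pos; [apply Rabs_pos|]. left. apply Rmult_lt_0_compat; assumption.
      + apply Rmult_le_pos; [lra|apply Rabs_pos].
    - right. field. lra. }
  exists (fun n x => Series (fun p => a p * v p n x)).
  split; [|split; [|split]].
  - apply (jet_series (fun p n x => a p * v p n x) B); [|exact HB].
    intros p n x. apply (is_derive_scal (v p n)). apply (Hvp p).
  - intros n. rewrite (Series_single _ n).
    + destruct (Hvp n) as [_ [H0 _]]. fold (v n) in H0. rewrite H0.
      destruct (Nat.eq_dec n n); [ring|congruence].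
    + intros p Hp. destruct (Hvp p) as [_ [H0 _]]. fold (v p) in H0. rewrite H0.
      destruct (Nat.eq_dec n p); [congruence|ring].
  - intros n x Hx. rewrite (Series_single _ 0%nat).
    + destruct (Hvp 0%nat) as [_ [_ [H0 _]]]. fold (v 0%nat) in H0.
      rewrite H0 by exact Hx. ring.
    + intros p Hp. destruct (Hvp p) as [_ [_ [H0 _]]]. fold (v p) in H0.
      rewrite H0 by exact Hx. ring.
  - intros n x. apply (Series_half_bound _ (B n)). intros p. apply HB.
Qed.

(** One stretching serves the real and the imaginary part, and every [h]: the
    condition on [h] compares the weight [N_n / (d_1 ... d_n)] of the
    constructed function with [h^n N_n]. *)
Lemma complex_extension (N d : nat -> R) (a : nat -> C) (c A : R) :
  moderate N c -> stretching N d ->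
  (forall p, Cmod (a p) * (2 * exp 11 * tau N 1 * d p) ^ p <= A * descendant N p) ->
  exists f, (forall p, Borel f p = a p) /\
    forall h, 0 < h ->
      (exists B, forall n, exp (1 + c) ^ n <= B * (h ^ n * stretch_prod d n)) ->
      D N h f.
Proof.
  intros HN Hd Ha.
  assert (HK : forall p, 0 <= (2 * exp 11 * tau N 1 * d p) ^ p).
  { intros p. apply pow_le. left. pose proof (exp_pos 11).
    pose proof (tau_pos N c HN 1). pose proof (stretch_pos N d Hd p).
    repeat apply Rmult_lt_0_compat; lra. }
  assert (Hpart : forall b : nat -> R, (forall p, Rabs (b p) <= Cmod (a p)) ->
    forall p, Rabs (b p) * (2 * exp 11 * tau N 1 * d p) ^ p <= A * descendant N p).
  { intros b Hb p. eapply Rle_trans; [|apply Ha].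
    apply Rmult_le_compat_r; [apply HK|apply Hb]. }
  destruct (real_extension N d (fun p => Re (a p)) c A HN Hd) as
    [u1 [Hu1 [H10 [H1o H1b]]]].
  { apply Hpart. intros p. eapply Rle_trans; [|apply Rmax_Cmod]. apply Rmax_l. }
  destruct (real_extension N d (fun p => Im (a p)) c A HN Hd) as
    [u2 [Hu2 [H20 [H2o H2b]]]].
  { apply Hpart. intros p. eapply Rle_trans; [|apply Rmax_Cmod]. apply Rmax_r. }
  set (f := fun x => (u1 0%nat x, u2 0%nat x) : C).
  assert (Hder : forall p x, CDerive_n f p x = (u1 p x, u2 p x)).
  { intros p x. unfold CDerive_n.
    change (fun t => Re (f t)) with (u1 0%nat). change (fun t => Im (f t)) with (u2 0%nat).
    rewrite !jet_Derive_n by assumption. reflexivity. }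
  exists f. split.
  { intros p. unfold Borel. rewrite Hder, H10, H20.
    destruct (a p); reflexivity. }
  intros h Hh [B HB]. split; [|split].
  - intros p x. split; apply jet_ex_derive_n; assumption.
  - intros x Hx.
    assert (Hx1 : Rabs x <= 1); [|apply Rabs_le_between in Hx1; exact Hx1].
    apply Rnot_lt_le. intros Hlt.
    assert (He : 0 < Rabs x - 1) by lra.
    destruct (Hx (disc x (mkposreal _ He))) as [y [Hy Hfy]].
    { exists (mkposreal _ He). intros z Hz. exact Hz. }
    apply Hfy. unfold disc in Hy. cbn [pos] in Hy.
    assert (Hy1 : 1 <= Rabs y).
    { pose proof (Rabs_triang_inv x y). rewrite Rabs_minus_sym in Hy. lra. }
    unfold f. rewrite H1o, H2o by exact Hy1. reflexivity.
  - exists (4 * (A * B)). intros y [p [x ->]]. rewrite Hder.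
    assert (HU := stretch_prod_pos d (stretch_pos N d Hd) p).
    assert (HNp := weight_pos N c HN p).
    assert (Hhp : 0 < h ^ p) by (apply pow_lt; exact Hh).
    assert (HA : 0 <= A).
    { specialize (Ha 0%nat). simpl in Ha. unfold descendant in Ha. simpl in Ha.
      pose proof (Cmod_ge_0 (a 0%nat)). lra. }
    set (E := exp (1 + c) ^ p * N p / stretch_prod d p) in *.
    assert (HE : E <= B * (h ^ p * N p)).
    { unfold E. apply Rmult_le_reg_r with (stretch_prod d p / N p).
      { apply Rdiv_lt_0_compat; assumption. }
      apply Rle_trans with (exp (1 + c) ^ p); [right; field; lra|].
      eapply Rle_trans; [apply HB|]. right. field. lra. }
    assert (Hmod : Cmod (u1 p x, u2 p x) <= 4 * (A * E)).
    { specialize (H1b p x). specialize (H2b p x). fold E in H1b, H2b.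
      replace ((u1 p x, u2 p x) : C) with (RtoC (u1 p x) + Ci * RtoC (u2 p x))%C.
      2: { unfold RtoC, Ci, Cplus, Cmult; simpl. f_equal; ring. }
      eapply Rle_trans; [apply Cmod_triangle|].
      rewrite Cmod_mult, !Cmod_R.
      assert (Hi : Cmod Ci = 1).
      { unfold Cmod, Ci; simpl. replace (0 * (0 * 1) + 1 * (1 * 1)) with 1 by ring.
        apply sqrt_1. }
      rewrite Hi. lra. }
    apply Rmult_le_reg_r with (h ^ p * N p); [apply Rmult_lt_0_compat; assumption|].
    unfold Rdiv. rewrite Rmult_assoc, Rinv_l, Rmult_1_r.
    2: { apply Rgt_not_eq, Rmult_lt_0_compat; assumption. }
    eapply Rle_trans; [exact Hmod|].
    replace (4 * (A * B) * (h ^ p * N p)) with (4 * (A * (B * (h ^ p * N p)))) by ring.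
    apply Rmult_le_compat_l; [lra|]. apply Rmult_le_compat_l; assumption.
Qed.

(** * Surjectivity of the Borel map *)

Lemma Lambda_bound (M : nat -> R) (h : R) (a : nat -> C) :
  positive M -> 0 < h -> Lambda M h a ->
  exists A, 0 < A /\ forall p, Cmod (a p) <= A * (h ^ p * M p).
Proof.
  intros HM Hh [A HA]. exists (Rmax A 1). split.
  { pose proof (Rmax_r A 1). lra. }
  intros p.
  assert (Hw : 0 < h ^ p * M p) by (apply Rmult_lt_0_compat; [apply pow_lt|]; auto).
  apply Rmult_le_reg_r with (/ (h ^ p * M p)); [apply Rinv_0_lt_compat; exact Hw|].
  rewrite Rmult_assoc, Rinv_r, Rmult_1_r by lra.
  eapply Rle_trans; [|apply Rmax_l]. apply HA. exists p. reflexivity.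
Qed.

Lemma Borel_covers_R (N : nat -> R) (c : R) :
  moderate N c -> Borel_covers (D_R N) (Lambda_R (descendant N)).
Proof.
  intros HN a [h [Hh Ha]].
  destruct (Lambda_bound _ h a (descendant_pos N c HN) Hh Ha) as [A [HA HaA]].
  assert (Ht0 := tail_pos N c HN 0).
  set (K := 2 * exp 11 * tau N 1).
  assert (HK : 0 < K).
  { unfold K. pose proof (exp_pos 11). pose proof (tau_pos N c HN 1).
    repeat apply Rmult_lt_0_compat; lra. }
  set (d := Rmin (/ (11 * tail N 0)) (/ (K * h))).
  assert (Hd : 0 < d).
  { apply Rmin_glb_lt; apply Rinv_0_lt_compat; [lra|].
    apply Rmult_lt_0_compat; assumption. }
  assert (HdK : K * d * h <= 1).
  { apply Rle_trans with (K * / (K * h) * h); [|right; field; lra].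
    apply Rmult_le_compat_r; [lra|]. apply Rmult_le_compat_l; [lra|]. apply Rmin_r. }
  destruct (complex_extension N (fun _ => d) a c A HN) as [f [Hf HD]].
  - split.
    + intros _. exact Hd.
    + intros _. lra.
    + intros j. pose proof (tail_mono N c HN j (S j) ltac:(lia)). nra.
    + apply Rle_trans with (11 * (/ (11 * tail N 0) * tail N 0)); [|right; field; lra].
      apply Rmult_le_compat_l; [lra|]. apply Rmult_le_compat_r; [lra|]. apply Rmin_l.
  - intros p. fold K. assert (HSp := descendant_pos N c HN p).
    apply Rle_trans with (A * (h ^ p * descendant N p) * (K * d) ^ p).
    + apply Rmult_le_compat_r; [|apply HaA]. apply pow_le. nra.
    + replace (A * (h ^ p * descendant N p) * (K * d) ^ p) with
        (A * descendant N p * (K * d * h) ^ p) by (rewrite !Rpow_mult_distr; ring).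
      rewrite <- (Rmult_1_r (A * descendant N p)) at 2.
      apply Rmult_le_compat_l; [nra|]. rewrite <- (pow1 p). apply pow_incr.
      split; [|exact HdK]. apply Rmult_le_pos; nra.
  - exists f. split; [|exact Hf]. exists (exp (1 + c) / d).
    assert (He : 0 < exp (1 + c) / d) by (apply Rdiv_lt_0_compat; [apply exp_pos|exact Hd]).
    split; [exact He|]. apply HD; [exact He|]. exists 1. intros n.
    assert (HU : stretch_prod (fun _ => d) n = d ^ n).
    { induction n as [|n IH]; simpl; [reflexivity|]. rewrite IH. ring. }
    rewrite HU, Rmult_1_l, <- Rpow_mult_distr. right. f_equal. field. lra.
Qed.

(** For the intersection of the spaces the stretching factors must tend to
    infinity.  They grow as fast as the condition on the tails permits, except
    at the steps where this would violate the bound [b_q d_p^q <= A] that the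
    given sequence imposes. *)
Fixpoint greedy_stretch (N b : nat -> R) (A d0 : R) (p : nat) : R :=
  match p with
  | O => d0
  | S p =>
      let d := greedy_stretch N b A d0 p in
      let d' := d * (1 + tail N p / tail N (S p)) / 2 in
      if excluded_middle_informative
           (forall q, (S p <= q)%nat -> b q * d' ^ q <= A)
      then d' else d
  end.

Lemma greedy_step (N : nat -> R) (c : R) : moderate N c ->
  forall p d, 0 < d ->
  let d' := d * (1 + tail N p / tail N (S p)) / 2 in
  d <= d' /\ 2 * (d' * tail N (S p)) = d * (tail N p + tail N (S p)) /\
  d ^ 2 * tail N p <= d' ^ 2 * tail N (S p).
Proof.
  intros HN p d Hd d'. assert (Ht := tail_pos N c HN (S p)).
  assert (Hmono := tail_mono N c HN p (S p) ltac:(lia)).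
  assert (Heq : 2 * (d' * tail N (S p)) = d * (tail N p + tail N (S p))).
  { unfold d'. field. lra. }
  split; [|split; [exact Heq|]].
  - apply Rmult_le_reg_r with (2 * tail N (S p)); [lra|]. nra.
  - (* the inequality between the arithmetic and the geometric mean of the tails *)
    apply Rmult_le_reg_r with (4 * tail N (S p)); [lra|].
    replace (d' ^ 2 * tail N (S p) * (4 * tail N (S p))) with
      ((2 * (d' * tail N (S p))) ^ 2) by ring.
    rewrite Heq. assert (0 <= d ^ 2 * (tail N p - tail N (S p)) ^ 2).
    { apply Rmult_le_pos; apply pow2_ge_0. }
    nra.
Qed.

Lemma greedy_stretch_pos (N b : nat -> R) (c A d0 : R) :
  moderate N c -> 0 < d0 -> positive (greedy_stretch N b A d0).
Proof.
  intros HN Hd0 p. induction p as [|p IH]; [exact Hd0|].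
  cbn -[Rdiv]. destruct (greedy_step N c HN p _ IH) as [H _].
  destruct (excluded_middle_informative _); lra.
Qed.

Lemma greedy_stretching (N b : nat -> R) (c A d0 : R) :
  moderate N c -> 0 < d0 -> 11 * (d0 * tail N 0) <= 1 ->
  stretching N (greedy_stretch N b A d0).
Proof.
  intros HN Hd0 Hsupp.
  assert (Hpos := greedy_stretch_pos N b c A d0 HN Hd0).
  split; [exact Hpos| | |exact Hsupp]; intros p;
    destruct (greedy_step N c HN p _ (Hpos p)) as [H1 [H2 _]];
    cbn -[Rdiv tail Rmult]; destruct (excluded_middle_informative _); try lra.
  pose proof (tail_mono N c HN p (S p) ltac:(lia)). pose proof (Hpos p). nra.
Qed.

Lemma greedy_stretch_bound (N b : nat -> R) (A d0 : R) :
  (forall q, b q * d0 ^ q <= A) ->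
  forall p q, (p <= q)%nat -> b q * greedy_stretch N b A d0 p ^ q <= A.
Proof.
  intros H0. induction p as [|p IH]; intros q Hq; [apply H0|].
  cbn -[Rdiv]. destruct (excluded_middle_informative _) as [H|H].
  - apply H. exact Hq.
  - apply IH. lia.
Qed.

(** As long as the factors stay below [X], the test succeeds for large [p],
    and then [d_p^2 t_p] does not decrease; since [t_p] tends to [0], the
    factors cannot stay below [X]. *)
Lemma greedy_stretch_lim (N b : nat -> R) (c A d0 : R) :
  moderate N c -> 0 < d0 -> (forall q, 0 <= b q) ->
  (forall X, 0 < X -> eventually (fun q => b q * X ^ q <= A)) ->
  forall X, 0 < X -> eventually (fun p => X <= greedy_stretch N b A d0 p).
Proof.
  intros HN Hd0 Hb0 Hb X HX. set (d := greedy_stretch N b A d0).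
  assert (Hpos : positive d) by apply (greedy_stretch_pos N b c A d0 HN Hd0).
  assert (Hc := const_pos N c HN).
  destruct (Hb (X * (1 + c)) ltac:(nra)) as [P HP].
  set (P1 := S P). set (e := d P1 ^ 2 * tail N P1).
  assert (He : 0 < e).
  { apply Rmult_lt_0_compat; [apply pow_lt, Hpos|apply (tail_pos N c HN)]. }
  assert (Hgrow : forall k, X <= d (P1 + k)%nat \/
                            e <= d (P1 + k)%nat ^ 2 * tail N (P1 + k)).
  { induction k as [|k IH]; [rewrite Nat.add_0_r; right; apply Rle_refl|].
    rewrite Nat.add_succ_r. set (p := (P1 + k)%nat) in *.
    destruct (greedy_step N c HN p _ (Hpos p)) as [H1 [H2 H3]].
    assert (Hstep : d (S p) = if excluded_middle_informative
      (forall q, (S p <= q)%nat ->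
         b q * (d p * (1 + tail N p / tail N (S p)) / 2) ^ q <= A)
      then d p * (1 + tail N p / tail N (S p)) / 2 else d p) by reflexivity.
    rewrite Hstep. clear Hstep.
    destruct (Rle_lt_dec X (d p)) as [Hx|Hx].
    { left. destruct (excluded_middle_informative _); lra. }
    destruct IH as [IH|IH]; [lra|]. right.
    destruct (excluded_middle_informative _) as [_|Hno]; [lra|].
    exfalso. apply Hno. intros q Hq.
    eapply Rle_trans; [|apply (HP q); unfold p, P1 in Hq; lia].
    apply Rmult_le_compat_l; [apply Hb0|]. apply pow_incr.
    assert (Hdp := Hpos p). split; [lra|].
    assert (Ht := tail_pos N c HN (S p)).
    assert (Hp1 : 1 <= INR p).
    { change 1 with (INR 1). apply le_INR. unfold p, P1. lia. }
    pose proof (inv_nu_le N c HN p ltac:(unfold p, P1; lia)) as Hnu.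
    assert (Hcp : c * tail N (S p) / INR p <= c * tail N (S p)).
    { apply Rmult_le_reg_r with (INR p); [lra|]. unfold Rdiv.
      rewrite Rmult_assoc, Rinv_l, Rmult_1_r by lra.
      rewrite <- (Rmult_1_r (c * tail N (S p))) at 1.
      apply Rmult_le_compat_l; [|exact Hp1]. apply Rmult_le_pos; lra. }
    pose proof (tail_S N c HN p) as HS.
    apply Rmult_le_reg_r with (2 * tail N (S p)); [lra|].
    apply Rle_trans with (d p * (tail N p + tail N (S p))); [fold d in H2; lra|].
    apply Rle_trans with (X * ((2 + 2 * c) * tail N (S p))); [|right; ring].
    apply Rmult_le_compat; lra || nra. }
  pose proof (tail_lim N c HN) as Hlim. apply is_lim_seq_spec in Hlim.
  assert (HX2 : 0 < X ^ 2) by (apply pow_lt; exact HX).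
  assert (He2 : 0 < e / X ^ 2) by (apply Rdiv_lt_0_compat; assumption).
  destruct (Hlim (mkposreal _ He2)) as [Q HQ]. cbn [pos] in HQ.
  exists (P1 + Q)%nat. intros p Hp.
  specialize (Hgrow (p - P1)%nat). replace (P1 + (p - P1))%nat with p in Hgrow by lia.
  destruct Hgrow as [H|H]; [exact H|].
  specialize (HQ p ltac:(lia)). rewrite Rminus_0_r, Rabs_pos_eq in HQ
    by (left; apply (tail_pos N c HN)).
  apply Rmult_lt_compat_r with (r := X ^ 2) in HQ; [|exact HX2].
  replace (e / X ^ 2 * X ^ 2) with e in HQ by (field; lra).
  apply Rnot_lt_le. intros Hlt. assert (Hdp := Hpos p).
  assert (d p ^ 2 <= X ^ 2) by (apply pow_incr; lra).
  pose proof (tail_pos N c HN p). nra.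
Qed.

Lemma stretch_prod_dominates (d : nat -> R) (k : R) :
  positive d -> 0 < k -> eventually (fun p => k <= d p) ->
  exists B, forall n, k ^ n <= B * stretch_prod d n.
Proof.
  intros Hd Hk [P HP].
  assert (HU := stretch_prod_pos d Hd).
  destruct (ex_finite_bound (fun n => k ^ n / stretch_prod d n) P) as [B [HB Hfin]].
  exists B. intros n. destruct (le_lt_dec n P) as [Hn|Hn].
  - specialize (Hfin n Hn). cbn beta in Hfin. specialize (HU n).
    apply Rmult_le_reg_r with (/ stretch_prod d n); [apply Rinv_0_lt_compat; exact HU|].
    rewrite (Rmult_assoc B), Rinv_r, Rmult_1_r by lra. exact Hfin.
  - replace n with (P + (n - P))%nat by lia. generalize (n - P)%nat. clear n Hn.
    induction n as [|i IH].
    + rewrite Nat.add_0_r. specialize (Hfin P (Nat.le_refl P)). cbn beta in Hfin.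
      specialize (HU P).
      apply Rmult_le_reg_r with (/ stretch_prod d P); [apply Rinv_0_lt_compat; exact HU|].
      rewrite (Rmult_assoc B), Rinv_r, Rmult_1_r by lra. exact Hfin.
    + rewrite Nat.add_succ_r. simpl. rewrite (Rmult_comm k), <- Rmult_assoc.
      apply Rmult_le_compat; [apply pow_le; lra|lra|exact IH|]. apply HP. lia.
Qed.

Lemma Borel_covers_B (N : nat -> R) (c : R) :
  moderate N c -> Borel_covers (D_B N) (Lambda_B (descendant N)).
Proof.
  intros HN a Ha.
  assert (HS := descendant_pos N c HN). assert (Ht0 := tail_pos N c HN 0).
  set (K := 2 * exp 11 * tau N 1).
  assert (HK : 0 < K).
  { unfold K. pose proof (exp_pos 11). pose proof (tau_pos N c HN 1).
    repeat apply Rmult_lt_0_compat; lra. }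
  set (d0 := / (11 * tail N 0)).
  assert (Hd0 : 0 < d0) by (apply Rinv_0_lt_compat; lra).
  set (b := fun q => Cmod (a q) / descendant N q * K ^ q).
  assert (Hb0 : forall q, 0 <= b q).
  { intros q. apply Rmult_le_pos; [|apply pow_le; lra].
    apply Rdiv_le_0_compat; [apply Cmod_ge_0|apply HS]. }
  assert (HbX : forall X, 0 < X -> exists B, 0 < B /\
            forall q, b q * X ^ q <= B * (1 / 2) ^ q).
  { intros X HX.
    assert (Hh : 0 < / (2 * K * X)).
    { apply Rinv_0_lt_compat, Rmult_lt_0_compat; [apply Rmult_lt_0_compat; lra|exact HX]. }
    destruct (Lambda_bound _ _ a HS Hh (Ha _ Hh)) as [B [HB HaB]].
    exists B. split; [exact HB|]. intros q. specialize (HaB q). specialize (HS q).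
    assert (HKX : 0 < K ^ q * X ^ q) by (apply Rmult_lt_0_compat; apply pow_lt; lra).
    unfold b.
    apply Rmult_le_reg_r with (descendant N q / (K ^ q * X ^ q)).
    { apply Rdiv_lt_0_compat; assumption. }
    assert (Hpow : K ^ q <> 0 /\ X ^ q <> 0).
    { split; apply pow_nonzero; lra. }
    apply Rle_trans with (Cmod (a q)); [right; field; repeat split; try lra; apply Hpow|].
    eapply Rle_trans; [exact HaB|]. right.
    rewrite pow_inv, !Rpow_mult_distr.
    replace ((1 / 2) ^ q) with (/ 2 ^ q) by (rewrite <- pow_inv; f_equal; lra).
    field. repeat split; try apply Hpow. apply pow_nonzero. lra. }
  destruct (HbX d0 Hd0) as [A0 [HA0 HbA0]].
  set (A := Rmax A0 1). assert (HA1 : 1 <= A) by apply Rmax_r.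
  assert (Hhalf : forall q, 0 < (1 / 2) ^ q <= 1).
  { intros q. split; [apply pow_lt; lra|]. apply Rle_trans with (1 ^ q); [|rewrite pow1; lra]. apply pow_incr. lra. }
  set (d := greedy_stretch N b A d0).
  assert (Hd : stretching N d).
  { apply (greedy_stretching N b c); auto. unfold d0. right. field. lra. }
  assert (Hbd : forall q, b q * d q ^ q <= A).
  { intros q. apply greedy_stretch_bound; [|lia]. intros p.
    eapply Rle_trans; [apply HbA0|]. apply Rle_trans with A0; [|apply Rmax_l].
    specialize (Hhalf p). nra. }
  assert (Hlim : forall X, 0 < X -> eventually (fun p => X <= d p)).
  { apply (greedy_stretch_lim N b c); auto. intros X HX.
    destruct (HbX X HX) as [B [HB HbB]].
    destruct (pow_lt_1_zero (1 / 2) ltac:(rewrite Rabs_pos_eq; lra) (/ B)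
      (Rinv_0_lt_compat _ HB)) as [P HP].
    exists P. intros q Hq. eapply Rle_trans; [apply HbB|].
    apply Rle_trans with 1; [|exact HA1].
    specialize (HP q ltac:(lia)). rewrite Rabs_pos_eq in HP by (left; apply Hhalf).
    apply Rle_trans with (B * / B); [|right; field; lra].
    apply Rmult_le_compat_l; lra. }
  destruct (complex_extension N d a c A HN Hd) as [f [Hf HD]].
  - intros p. fold K. specialize (Hbd p). unfold b in Hbd. specialize (HS p).
    rewrite Rpow_mult_distr.
    apply Rmult_le_reg_r with (/ descendant N p); [apply Rinv_0_lt_compat; exact HS|].
    rewrite (Rmult_assoc A), Rinv_r, Rmult_1_r by lra.
    eapply Rle_trans; [|exact Hbd]. right. unfold Rdiv. ring.
  - exists f. split; [|exact Hf]. intros h Hh. apply HD; [exact Hh|].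
    assert (He := exp_pos (1 + c)).
    destruct (stretch_prod_dominates d (exp (1 + c) / h)) as [B HB].
    + apply (stretch_pos N d Hd).
    + apply Rdiv_lt_0_compat; assumption.
    + apply Hlim, Rdiv_lt_0_compat; assumption.
    + exists B. intros n. specialize (HB n).
      assert (Hhn : 0 < h ^ n) by (apply pow_lt; exact Hh).
      apply Rmult_le_reg_r with (/ h ^ n); [apply Rinv_0_lt_compat; exact Hhn|].
      unfold Rdiv in HB. rewrite Rpow_mult_distr, pow_inv in HB.
      eapply Rle_trans; [exact HB|]. right. field. lra.
Qed.

(** * The descendant as an optimal sequence *)

Theorem theorem3p11 (N : nat -> R) :
  LC N ->
  nonquasianalytic N ->
  Rbar_lt 0 (LimInf_seq (fun p => nu N p / INR p * tail N (2 * p))) ->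
  (* (i) *)
  (forall s : nat, (1 <= s)%nat -> equiv (descendant N) (Lseq N s)) /\
  (* (ii) *)
  (preceq_maximal (fun M => class_R N M /\ SV M N) (descendant N) /\
   preceq_maximal (fun M => class_B N M /\ SV M N) (descendant N) /\
   preceq_maximal (fun M => class_LC_R N M /\ SV M N) (descendant N) /\
   preceq_maximal (fun M => class_LC_B N M /\ SV M N) (descendant N)) /\
  (* (iii) *)
  ((Borel_covers (D_R N) (Lambda_R (descendant N)) /\
    forall M, class_R N M -> Borel_covers (D_R N) (Lambda_R M) ->
              preceq M (descendant N)) /\
   (Borel_covers (D_B N) (Lambda_B (descendant N)) /\
    forall M, class_B N M -> Borel_covers (D_B N) (Lambda_B M) ->
              preceq M (descendant N))).
Proof.
  intros HLC Hnqa Hinf.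
  destruct (moderate_intro N HLC Hnqa Hinf) as [c HN].
  assert (HB := descendant_class_B N c HN). assert (HR := class_B_R _ _ HB).
  assert (HSV := descendant_SV N c HN). assert (HL := descendant_LC N c HN).
  assert (Hmax := fun M => SV_preceq_descendant N M c HN).
  split; [|split].
  - intros s Hs. apply (descendant_equiv_Lseq N c); assumption.
  - split; [|split; [|split]]; split; try (intros M HM; apply Hmax; apply HM);
      split; auto; split; auto.
  - split; split.
    + apply (Borel_covers_R N c HN).
    + intros M HM Hcov. apply (test_sequence_optimal N M c HN (proj1 HM)).
      intros a Ha. destruct (Hcov a (Lambda_B_R M a Ha)) as [f [[h [Hh Hf]] Hfa]].
      exists h, f. split; [exact Hh|]. split; assumption.
    + apply (Borel_covers_B N c HN).
    + intros M HM Hcov. apply (test_sequence_optimal N M c HN (proj1 HM)).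
      intros a Ha. destruct (Hcov a Ha) as [f [Hf Hfa]].
      exists 1, f. split; [lra|]. split; [apply Hf; lra|exact Hfa].
Qed.
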